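(* The $W_3$-Subdivision problem can be solved in $O(n^6(n+m))$ time, where $n$ and $m$ are the numbers of vertices and arcs of the input digraph.
   Context: All digraphs are strict. $W_3$ (the $3$-wheel) is the digraph obtained from the directed cycle on $3$ vertices by adding a vertex (the centre) with an arc to each vertex of the cycle. A subdivision of a digraph $F$ (an $F$-subdivision) is a digraph obtained from $F$ by replacing each arc $ab$ of $F$ by a directed path from $a$ to $b$. The $F$-Subdivision problem: given a digraph $D$, decide whether $D$ contains an $F$-subdivision as a subdigraph. *)

(* Defs.v *)
From mathcomp Require Import all_boot.

Set Implicit Arguments.
Unset Strict Implicit.
Unset Printing Implicit Defensive.

(** * Strict digraphs and subdivisions *)

(** No loops and, the arcs being a relation, no parallel arcs.  Opposite arcs
    [x -> y], [y -> x] are allowed. *)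
Record digraph := Digraph {
  vertex :> finType;
  arc : rel vertex;
  arc_irr : irreflexive arc }.

Definition num_arcs (D : digraph) : nat :=
  #|[set xy : D * D | arc xy.1 xy.2]|.

(** [None] is the centre; [ordS] is the cyclic successor. *)
Definition W3_arc : rel (option 'I_3) := fun x y =>
  match x, y with
  | None, Some _ => true
  | Some i, Some j => j == ordS i
  | _, None => false
  end.

Lemma W3_arc_irr : irreflexive W3_arc.
Proof. by case=> // -[[|[|[|]]]]. Qed.

Definition W3 : digraph := Digraph W3_arc_irr.

(** [P a b] lists the internal vertices of the directed path that replaces the
    arc [ab]; it may be empty.  Its values on non-arcs are irrelevant. *)
Definition subdivision_path (F S : digraph) (phi : F -> S) (P : F -> F -> seq S)
    (a b : F) : seq S :=
  phi a :: rcons (P a b) (phi b).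

Definition is_subdivision (F S : digraph) : Prop :=
  exists (phi : F -> S) (P : F -> F -> seq S),
  [/\ injective phi,
      forall a b, arc a b -> uniq (P a b),
      forall a b, arc a b -> forall x, x \in P a b -> x \notin codom phi,
      forall a b c d, arc a b -> arc c d ->
        forall x, x \in P a b -> x \in P c d -> (a, b) = (c, d)
    & (forall x : S, x \in codom phi \/
         exists a b : F, arc a b /\ x \in P a b) /\
      (forall x y : S, arc x y <->
         exists a b : F, arc a b /\ infix [:: x; y] (subdivision_path phi P a b))].

(** [S] is (isomorphic to) a subdigraph of [D], not necessarily induced. *)
Definition embeds (S D : digraph) : Prop :=
  exists h : S -> D, injective h /\ {homo h : x y / arc x y}.

Definition contains_subdivision (F D : digraph) : Prop :=
  exists S : digraph, is_subdivision F S /\ embeds S D.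

(** * Word RAM

    Structured programs over numbered registers and numbered random-access
    arrays.  A program names its registers and arrays by constants, so it uses
    finitely many of each; the arrays can be interleaved in a single memory at
    the cost of a constant factor.  Every instruction and every test takes one
    unit of time. *)

Inductive operand := Const of nat | Reg of nat.

Inductive binop := Add | Sub | Mul | Div.

Inductive comparison := Lt | Le | Eq | Ne.

Inductive program :=
| Skip
| Assign of nat & binop & operand & operand      (* r := x op y *)
| Read of nat & nat & operand                    (* r := A[x] *)
| Write of nat & operand & operand               (* A[x] := y *)
| Seq of program & program
| If of comparison & operand & operand & program & program
| While of comparison & operand & operand & program.

Record state := State { reg : nat -> nat; arr : nat -> nat -> nat }.

Definition set_reg (s : state) (r v : nat) : state :=
  State (fun i => if i == r then v else reg s i) (arr s).

Definition set_arr (s : state) (a i v : nat) : state :=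
  State (reg s) (fun b j => if (b == a) && (j == i) then v else arr s b j).

Definition value (s : state) (x : operand) : nat :=
  match x with Const c => c | Reg r => reg s r end.

Definition compute (op : binop) (x y : nat) : nat :=
  match op with
  | Add => x + y | Sub => x - y | Mul => x * y | Div => x %/ y
  end.

Definition test (c : comparison) (x y : nat) : bool :=
  match c with
  | Lt => x < y | Le => x <= y | Eq => x == y | Ne => x != y
  end.

(** [exec W p s t s']: started in [s], the program [p] halts after exactly [t]
    steps in [s'], and every value it writes is less than [W].  There is no
    rule for a write of a value [>= W], so an overflowing run never counts as
    halting. *)
Inductive exec (W : nat) : program -> state -> nat -> state -> Prop :=
| exec_Skip s : exec W Skip s 1 s
| exec_Assign r op x y s :
    compute op (value s x) (value s y) < W ->
    exec W (Assign r op x y) s 1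
      (set_reg s r (compute op (value s x) (value s y)))
| exec_Read r a x s :
    arr s a (value s x) < W ->
    exec W (Read r a x) s 1 (set_reg s r (arr s a (value s x)))
| exec_Write a x y s :
    value s y < W ->
    exec W (Write a x y) s 1 (set_arr s a (value s x) (value s y))
| exec_Seq p q s t s' u s'' :
    exec W p s t s' -> exec W q s' u s'' ->
    exec W (Seq p q) s (t + u) s''
| exec_If c x y p q s t s' :
    exec W (if test c (value s x) (value s y) then p else q) s t s' ->
    exec W (If c x y p q) s t.+1 s'
| exec_WhileT c x y p s t s' u s'' :
    test c (value s x) (value s y) ->
    exec W p s t s' -> exec W (While c x y p) s' u s'' ->
    exec W (While c x y p) s (t + u).+1 s''
| exec_WhileF c x y p s :
    ~~ test c (value s x) (value s y) ->
    exec W (While c x y p) s 1 s.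

Lemma exec_det W p s t s' u s'' :
  exec W p s t s' -> exec W p s u s'' -> t = u /\ s' = s''.
Proof.
move=> E; elim: E u s'' => {p s t s'}; intros;
  match goal with
  | H : exec _ Skip _ _ _ |- _ => inversion H
  | H : exec _ (Assign _ _ _ _) _ _ _ |- _ => inversion H
  | H : exec _ (Read _ _ _) _ _ _ |- _ => inversion H
  | H : exec _ (Write _ _ _) _ _ _ |- _ => inversion H
  | H : exec _ (Seq _ _) _ ?v ?s |- ?t = ?v /\ _ => inversion H
  | H : exec _ (If _ _ _ _ _) _ ?v _ |- _ = ?v /\ _ => inversion H
  | H : exec _ (While _ _ _ _) _ ?v _ |- _ = ?v /\ _ => inversion H
  end; subst => //;
  try (exfalso; match goal with
       | H : is_true (~~ ?b), H' : is_true ?b |- _ => by rewrite H' in H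
       end);
  repeat match goal with
  | IH : forall u s, exec _ ?p ?s0 u s -> _ /\ _, H : exec _ ?p ?s0 _ _ |- _ =>
      case: (IH _ _ H) => ? ?; clear IH; subst
  end => //.
Qed.

(** * Digraph problems and their time complexity *)

(** Lists of out-neighbours, each in an arbitrary order. *)
Definition adjacency_lists (n : nat) (e : rel 'I_n) (adj : 'I_n -> seq 'I_n) :
    Prop :=
  forall u, uniq (adj u) /\ forall v, (v \in adj u) = e u v.

(** Register 0 holds [n], array 1 the concatenation of the lists
    [adj 0, ..., adj n.-1], and array 0 the [n.+1] offsets delimiting them: the
    list of [u] occupies positions [A0[u], ..., A0[u+1] - 1] of array 1.
    Everything else is 0. *)
Definition offsets (n : nat) (adj : 'I_n -> seq 'I_n) : seq nat :=
  0 :: scanl addn 0 [seq size (adj u) | u <- enum 'I_n].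

Definition heads (n : nat) (adj : 'I_n -> seq 'I_n) : seq nat :=
  flatten [seq [seq val v | v <- adj u] | u <- enum 'I_n].

Definition input_state (n : nat) (adj : 'I_n -> seq 'I_n) : state :=
  State (fun r => if r == 0 then n else 0)
        (fun a i => if a == 0 then nth 0 (offsets adj) i
                    else if a == 1 then nth 0 (heads adj) i else 0).

(** The decision problem [Q] can be solved in [O(f(n, m))] time, on words of
    [O(log (n + m))] bits: values stay below [(n + m + 2) ^ k] for a constant
    [k].  The answer is left in register 0.  The answer must be right on the
    empty digraph too, but the bound is only required for [n > 0], since
    [f 0 0] may be 0. *)
Definition solvable_in_time_O (Q : digraph -> Prop) (f : nat -> nat -> nat) :
    Prop :=
  exists (p : program) (k C : nat),
  forall (n : nat) (e : rel 'I_n) (e_irr : irreflexive e)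
         (adj : 'I_n -> seq 'I_n),
  adjacency_lists e adj ->
  let D := Digraph e_irr in
  let m := num_arcs D in
  exists (t : nat) (s : state),
  [/\ exec ((n + m + 2) ^ k) p (input_state adj) t s,
      (Q D /\ reg s 0 = 1) \/ (~ Q D /\ reg s 0 = 0)
    & 0 < n -> t <= C * f n m].

(* Main.v *)
Require Import Defs.
From mathcomp Require Import all_boot zify.
(* [path.arc] would otherwise hide the arc relation of digraphs. *)
Import Defs.

Set Implicit Arguments.
Unset Strict Implicit.
Unset Printing Implicit Defensive.

(** A subdivision of W_3 with centre [v] is a directed cycle [C] avoiding [v]
    together with three paths from [v] to [C] that share only [v].  Call
    [w, x, z] linked if no two vertices separate [v] from all three of them, and
    call a vertex undominated if no single other vertex separates [v] from it.

    Suppose that [C] carries such a subdivision.  The three ends of the spokes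
    are undominated and linked.  If no three consecutive undominated vertices of
    [C] were linked, each such triple would lie in a set with at most two entry
    vertices; two such sets sharing two undominated vertices have a union of the
    same kind, because the number of entry vertices is submodular, and so one
    such set would contain all the ends.  Hence some consecutive undominated [w],
    [x], [z] on [C] are linked.  The part of [C] from [w] to [x] is dominated by
    [w], the part from [x] to [z] by [x], and the rest leads from [z] to [w]
    avoiding [x] and [v].

    Conversely, if linked [w], [x], [z] admit such walks, then the regions
    dominated by [w] and by [x] are disjoint and the third walk avoids both, so
    the walks close up to a directed cycle through [w], [x], [z], and Menger's
    theorem supplies the spokes.

    The condition is a first-order formula of quantifier depth six over one
    four-place table ("[u] is reachable from [s] avoiding [a] and [b]").  The
    table is filled by [O(n)] rounds of [O(n^5)] steps each, so the total time is
    [O(n^6)]. *)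

(** * Subdivisions as families of internally disjoint paths in the host digraph *)

Lemma path_infixP (T : eqType) (e : rel T) x s :
  path e x s <-> forall y z, infix [:: y; z] (x :: s) -> e y z.
Proof.
split.
  move=> Hp y z /infixP [s1 [s2 E]].
  case: s1 E => [|c s1] /= [] E1 E2.
    by move: Hp; rewrite E2 /= E1 => /andP [].
  move: Hp; rewrite E2 cat_path /= => /andP [_] /andP [_] /andP [] //.
elim: s x => // y s IH x H; apply/andP; split.
  by apply: H; rewrite /= !eqxx prefix0s.
by apply: IH => a b Hab; apply: H; rewrite infix_consl Hab orbT.
Qed.

(** The intermediate digraph disappears: its paths are mapped along the embedding. Conversely it is
    rebuilt on the vertices lying on the paths, with exactly the arcs that the paths traverse; it
    has no loops because [D] has none. *)
Lemma contains_subdivisionP (F D : digraph) :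
  contains_subdivision F D <->
  exists (phi : F -> D) (P : F -> F -> seq D),
  [/\ injective phi,
      forall a b, arc a b -> uniq (P a b),
      forall a b, arc a b -> forall x, x \in P a b -> x \notin codom phi,
      forall a b c d, arc a b -> arc c d ->
        forall x, x \in P a b -> x \in P c d -> (a, b) = (c, d)
    & forall a b, arc a b -> path (@arc D) (phi a) (rcons (P a b) (phi b))].
Proof.
split.
  case=> S [[phi [P [phi_inj Pu Pphi Pdisj [Scov Sarc]]]] [h [h_inj h_arc]]].
  exists (h \o phi), (fun a b => map h (P a b)); split.
  - exact: inj_comp.
  - by move=> a b ab; rewrite map_inj_uniq ?Pu.
  - move=> a b ab _ /mapP [x xP ->].
    apply/negP => /codomP [c /= /h_inj xc].
    by move: (Pphi _ _ ab _ xP); rewrite xc codom_f.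
  - move=> a b c d ab cd _ /mapP [x xP ->] /mapP [y yP /h_inj xy].
    by apply: (Pdisj _ _ _ _ ab cd x) => //; rewrite xy.
  - move=> a b ab /=; rewrite -map_rcons path_map.
    apply: (@sub_path _ (@arc S)); first by move=> x y /h_arc.
    by apply/path_infixP => y z Hyz; apply/Sarc; exists a, b.
case=> phi [P [phi_inj Pu Pphi Pdisj Ppath]].
pose used x := (x \in codom phi) || [exists a, exists b, arc a b && (x \in P a b)].
have used_phi a : used (phi a) by rewrite /used codom_f.
have used_P a b x : arc a b -> x \in P a b -> used x.
  move=> ab xP; apply/orP; right; apply/existsP; exists a; apply/existsP; exists b.
  by rewrite ab.
pose T := {x : D | used x}.
pose phiT a : T := exist _ (phi a) (used_phi a).
(* For an arc [ab], [insub] is defined on every vertex of the path, so [pmap] only changes the type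
   and drops nothing. *)
pose PT a b : seq T := pmap insub (P a b).
have PTE a b : arc a b -> map val (PT a b) = P a b.
  move=> ab; rewrite /PT (pmap_filter (insubK _)); apply/all_filterP/allP => x xP.
  by rewrite isSome_insub; apply: used_P ab xP.
have memPT a b x : arc a b -> (x \in PT a b) = (val x \in P a b).
  by move=> ab; rewrite -PTE // mem_map //; apply: val_inj.
pose eT : rel T := fun x y => [exists a, exists b, arc a b &&
  infix [:: x; y] (phiT a :: rcons (PT a b) (phiT b))].
have PTpath a b : arc a b ->
    path (relpre val (@arc D)) (phiT a) (rcons (PT a b) (phiT b)).
  by move=> ab; rewrite -path_map map_rcons PTE //=; apply: Ppath.
have eTD x y : eT x y -> arc (val x) (val y).
  case/existsP => a /existsP [b /andP [ab]].
  by move: x y; apply/path_infixP; apply: PTpath.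
have eT_irr : irreflexive eT.
  by move=> x; apply/negbTE/negP => /eTD; rewrite arc_irr.
exists (Digraph eT_irr); split; last first.
  by exists val; split; [exact: val_inj | exact: eTD].
exists phiT, PT; split.
- by move=> a b /(congr1 val) /= /phi_inj.
- by move=> a b ab; rewrite -(map_inj_uniq val_inj) PTE ?Pu.
- move=> a b ab x; rewrite memPT // => xP.
  apply/negP => /codomP [c xc]; move: (Pphi _ _ ab _ xP).
  by rewrite xc /= codom_f.
- by move=> a b c d ab cd x; rewrite !memPT //; apply: Pdisj.
split.
  move=> x; case/orP: (valP x).
    case/codomP => a xa; left; apply/codomP; exists a; exact: val_inj.
  case/existsP => a /existsP [b /andP [ab xP]]; right; exists a, b.
  by split=> //; rewrite memPT.
move=> x y; split.
  by case/existsP => a /existsP [b /andP [ab xy]]; exists a, b.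
case=> a [b [ab xy]]; apply/existsP; exists a; apply/existsP; exists b.
by rewrite ab.
Qed.

(** * Menger's theorem *)

Section InBoundary.

Variable T : finType.
Implicit Types (e : rel T) (U W B : {set T}).

(** The vertices through which walks from outside enter [U]; they serve as vertex cuts. *)
Definition in_boundary e U := [set q in U | [exists p, (p \notin U) && e p q]].

Lemma in_boundaryP e U q :
  reflect (q \in U /\ exists2 p, p \notin U & e p q) (q \in in_boundary e U).
Proof.
rewrite inE; apply: (iffP andP) => -[qU].
  by case/existsP => p /andP [pU pq]; split=> //; exists p.
by case=> p pU pq; split=> //; apply/existsP; exists p; rewrite pU.
Qed.

Lemma in_boundary_cap_cup e U W :
  in_boundary e (U :&: W) :|: in_boundary e (U :|: W)
    \subset in_boundary e U :|: in_boundary e W.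
Proof.
apply/subsetP => q; rewrite inE => /orP [] /in_boundaryP [].
  rewrite inE => /andP [qU qW] [p]; rewrite inE negb_and => /orP [pU|pW] pq.
    by rewrite inE; apply/orP; left; apply/in_boundaryP; split=> //; exists p.
  by rewrite inE; apply/orP; right; apply/in_boundaryP; split=> //; exists p.
rewrite inE => /orP [qU|qW] [p]; rewrite inE negb_or => /andP [pU pW] pq.
  by rewrite inE; apply/orP; left; apply/in_boundaryP; split=> //; exists p.
by rewrite inE; apply/orP; right; apply/in_boundaryP; split=> //; exists p.
Qed.

Lemma in_boundary_cap_cap_cup e U W :
  in_boundary e (U :&: W) :&: in_boundary e (U :|: W)
    \subset in_boundary e U :&: in_boundary e W.
Proof.
apply/subsetP => q; rewrite inE => /andP [] /in_boundaryP [].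
rewrite inE => /andP [qU qW] _ /in_boundaryP [_ [p]].
rewrite inE negb_or => /andP [pU pW] pq.
by rewrite inE; apply/andP; split; apply/in_boundaryP; split=> //; exists p.
Qed.

(** [cardsUI] turns both sums into the size of a union plus the size of an intersection, and the two
    inclusions above compare these separately. *)
Lemma in_boundary_submod e U W :
  #|in_boundary e (U :&: W)| + #|in_boundary e (U :|: W)|
    <= #|in_boundary e U| + #|in_boundary e W|.
Proof.
rewrite -cardsUI -[X in _ <= X]cardsUI.
apply: leq_add; apply: subset_leq_card.
  exact: in_boundary_cap_cup.
exact: in_boundary_cap_cap_cup.
Qed.

Definition delete_arc e p q : rel T := fun x y => e x y && ((x, y) != (p, q)).

Lemma num_delete_arc e p q : e p q ->
  #|[set xy : T * T | delete_arc e p q xy.1 xy.2]| < #|[set xy : T * T | e xy.1 xy.2]|.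
Proof.
move=> epq; apply: proper_card; apply/properP; split.
  by apply/subsetP => -[x y]; rewrite !inE => /andP [].
by exists (p, q); rewrite !inE //= /delete_arc eqxx andbF.
Qed.

(** A violation of Menger's condition for the root [v] and the target set [B]. *)
Definition separates_less e (v : T) B U :=
  [&& v \notin U, B \subset U & #|in_boundary e U| < #|B|].

(** The set violating the condition after the deletion did not violate it before, so it had exactly
    one entry vertex more. Only [q] can have been lost, and it is lost because [p] was its only
    in-neighbour outside. *)
Lemma critical_arc e v B p q :
  (forall U, ~~ separates_less e v B U) -> e p q ->
  (exists U, separates_less (delete_arc e p q) v B U) ->
  exists U, [/\ v \notin U, B \subset U, #|in_boundary e U| = #|B|, q \in U &
    (p \notin U) /\ (forall p', p' \notin U -> e p' q -> p' = p)].
Proof.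
move=> conn epq [U /and3P [vU BU lt]].
have le : #|B| <= #|in_boundary e U|.
  by move: (conn U); rewrite /separates_less vU BU /= -leqNgt.
have nsub : ~~ (in_boundary e U \subset in_boundary (delete_arc e p q) U).
  by apply/negP => /subset_leq_card; lia.
case/subsetPn: nsub => x /in_boundaryP [xU [p' p'U p'x]] xN.
have uniq_in r : r \notin U -> e r x -> (r, x) = (p, q).
  move=> rU rx; apply/eqP; apply: contraNT xN => ne.
  by apply/in_boundaryP; split=> //; exists r; rewrite // /delete_arc rx.
have [Ep Ex] := uniq_in _ p'U p'x; subst p' x.
exists U; split=> //; last first.
  by split=> // r rU rq; case: (uniq_in _ rU rq).
apply/eqP; rewrite eqn_leq le andbT.
have : in_boundary e U \subset q |: in_boundary (delete_arc e p q) U.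
  apply/subsetP => y /in_boundaryP [yU [r rU ry]]; rewrite in_setU1.
  case: eqVneq => //= yq; apply/in_boundaryP; split=> //; exists r => //.
  by rewrite /delete_arc ry; apply/eqP => -[_ /eqP]; apply/negP.
move/subset_leq_card; rewrite cardsU1; move: lt; case: (_ \notin _) => /=; lia.
Qed.

(** * Digraphs in which every arc is critical *)

Section Critical.

Variables (e : rel T) (v : T) (B : {set T}).
Hypothesis connected : forall U, ~~ separates_less e v B U.
Hypothesis critical : forall p q, e p q ->
  exists U, separates_less (delete_arc e p q) v B U.

(* If two arcs [pq], [p'q] were both critical, witnessed by the tight sets [U] and
   [W], then [q] would be an entry vertex of [U], [W] and [U :&: W] but not of
   [U :|: W], making submodularity strict. *)
Lemma critical_indegree p p' q : e p q -> e p' q -> p = p'.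
Proof.
move=> pq p'q; apply/eqP; apply/negPn/negP => ne.
have [U [vU BU cU qU [pU Up]]] := critical_arc connected pq (critical pq).
have [W [vW BW cW qW [pW Wp]]] := critical_arc connected p'q (critical p'q).
have pinW : p \in W.
  by apply/negPn/negP => pNW; case/eqP: ne; apply: Wp.
have p'inU : p' \in U.
  by apply/negPn/negP => pNU; case/eqP: ne; rewrite -(Up p').
have strict : #|in_boundary e (U :&: W)| + #|in_boundary e (U :|: W)|
    < #|in_boundary e U| + #|in_boundary e W|.
  rewrite -cardsUI -[X in _ < X]cardsUI -addnS leq_add //.
    by apply: subset_leq_card; apply: in_boundary_cap_cup.
  apply: proper_card; apply/properP; split.
    exact: in_boundary_cap_cap_cup.
  exists q.
    rewrite inE; apply/andP; split; apply/in_boundaryP; split=> //.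
      by exists p.
    by exists p'.
  rewrite inE negb_and; apply/orP; right; apply/in_boundaryP => -[_ [r]].
  rewrite inE negb_or => /andP [rU rW] rq.
  by case/negP: rW; rewrite (Up _ rU rq).
have H1 := connected (U :&: W); have H2 := connected (U :|: W).
move: H1 H2; rewrite /separates_less !inE (negbTE vU) (negbTE vW) /=.
rewrite subsetI BU BW (subset_trans BU (subsetUl _ _)) /=.
by move: strict; rewrite cU cW; clear; lia.
Qed.

Lemma critical_root p : ~~ e p v.
Proof.
apply/negP => pv.
have [U [vU _ _ qU _]] := critical_arc connected pv (critical pv).
by rewrite qU in vU.
Qed.

(** By [critical_indegree] there is at most one in-neighbour to pick. A vertex without in-neighbours
    is its own [pre], so chains of iterates become constant there. *)
Let pre q := odflt q [pick p | e p q].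

Let pre_arc p q : e p q -> pre q = p.
Proof.
rewrite /pre => pq; case: pickP => [r rq|/(_ p)]; last by rewrite pq.
exact: critical_indegree rq pq.
Qed.

Let pre_root i : iter i pre v = v.
Proof.
elim: i => //= i ->; rewrite /pre; case: pickP => // p pv.
by move: (critical_root p); rewrite pv.
Qed.

Let pre_after k i b : k <= i -> iter k pre b = v -> iter i pre b = v.
Proof. by move=> /subnK <- Ek; rewrite iterD Ek pre_root. Qed.

Hypothesis vB : v \notin B.

Let anc_closed U b : b \in B -> v \notin U -> B \subset U ->
  ~ (in_boundary e U \subset B :\ b).
Proof.
move=> bB vU BU /subset_leq_card; move: (connected U).
rewrite /separates_less vU BU /= -leqNgt.
have := cardsD1 b B; rewrite bB /=; lia.
Qed.

Let chain_root b : b \in B -> exists i, iter i pre b = v.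
Proof.
move=> bB; case: (boolP (v \in orbit pre b)) => [|vN].
  by rewrite -fconnect_orbit => /iter_findex Ei; exists (findex pre b v).
exfalso; pose U := B :|: [set x in orbit pre b].
have vU : v \notin U by rewrite !inE negb_or vB vN.
apply: (anc_closed bB vU (subsetUl _ _)).
apply/subsetP => q /in_boundaryP []; rewrite !inE => qU [p].
rewrite !inE negb_or => /andP [pB pO] pq.
have qO : q \notin orbit pre b.
  apply: contra pO; rewrite -!fconnect_orbit => bq.
  rewrite -(pre_arc pq); exact: connect_trans bq (fconnect1 _ _).
move: qU; rewrite (negbTE qO) orbF => qB; rewrite qB andbT.
by apply: contraNneq qO => ->; rewrite -fconnect_orbit connect0.
Qed.

(** If two chains met at a vertex other than [v], adding both chains up to that vertex to [B] would
    leave as entry vertices at most the meeting point and [B] without [b] and [b'], fewer than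
    [connected] demands. *)
Let chain_disjoint b b' i j : b \in B -> b' \in B -> b != b' ->
  iter i pre b = iter j pre b' -> iter i pre b = v.
Proof.
move=> bB b'B ne Eij; apply/eqP; apply/negPn/negP => cv.
pose U := B :|: [set x in traject pre b i.+1 ++ traject pre b' j.+1].
have vU : v \notin U.
  rewrite in_setU in_set negb_or vB andTb mem_cat negb_or; apply/andP; split.
    apply: contra cv => /trajectP [k kl /esym Ev].
    by rewrite (pre_after _ Ev).
  apply: contra cv => /trajectP [k kl /esym Ev].
  by rewrite Eij (pre_after _ Ev).
have in_chain a k l q p : (forall r, r <= l -> iter r pre a \in U) ->
    k <= l -> q = iter k pre a -> p \notin U -> e p q -> q = iter l pre a.
  move=> sub kl Eq pU pq; move: kl; rewrite leq_eqVlt => /orP [/eqP <- //|kl].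
  by case/negP: pU; rewrite -(pre_arc pq) Eq -iterS; apply: sub.
have sub : in_boundary e U \subset iter i pre b |: (B :\ b :\ b').
  apply/subsetP => q /in_boundaryP [qU [p pU pq]]; rewrite !inE.
  have ch1 k : k <= i -> q = iter k pre b -> q = iter i pre b.
    move=> ki Eq; apply: (in_chain _ _ _ _ _ _ ki Eq pU pq) => r ri.
    rewrite in_setU in_set mem_cat; apply/orP; right; apply/orP; left.
    by apply/trajectP; exists r.
  have ch2 k : k <= j -> q = iter k pre b' -> q = iter j pre b'.
    move=> kj Eq; apply: (in_chain _ _ _ _ _ _ kj Eq pU pq) => r rj.
    rewrite in_setU in_set mem_cat; apply/orP; right; apply/orP; right.
    by apply/trajectP; exists r.
  case: eqVneq => //= qc.
  have qb : q != b by apply: contraNneq qc => qb; apply/eqP; exact: (ch1 0).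
  have qb' : q != b'.
    by apply: contraNneq qc => qb'; apply/eqP; rewrite Eij; exact: (ch2 0).
  rewrite qb qb' /=; move: qU; rewrite in_setU in_set mem_cat => /or3P [//||].
    by case/trajectP => k kl Eq; case/eqP: qc; apply: ch1 Eq.
  by case/trajectP => k kl Eq; case/eqP: qc; rewrite Eij; apply: ch2 Eq.
have := subset_leq_card sub; rewrite cardsU1.
have := connected U; rewrite /separates_less vU subsetUl /= -leqNgt.
have := cardsD1 b B; have := cardsD1 b' (B :\ b).
rewrite bB !inE b'B eq_sym ne /=.
have := leq_b1 (iter i pre b \notin B :\ b :\ b'); clear; lia.
Qed.

Lemma critical_linkage : exists P : T -> seq T,
  (forall b, b \in B -> [/\ path e v (P b), last v (P b) = b, uniq (P b) & v \notin P b])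
  /\ {in B &, forall b b', b != b' -> forall x, x \in P b -> x \notin P b'}.
Proof.
have chain_path b : b \in B -> exists p, [/\ path e v p, last v p = b,
    uniq p, v \notin p & forall x, x \in p -> exists i, iter i pre b = x].
  move=> bB; have [i Ei] := chain_root bB.
  have : exists p, [/\ path e v p, last v p = b &
      forall x, x \in p -> exists i, iter i pre b = x].
    elim: i b Ei {bB} => [|i IH] b Ei; first by exists [::].
    rewrite iterSr in Ei; have [p [pp pl pi]] := IH _ Ei.
    case: (boolP (e (pre b) b)) => [eb|neb].
      exists (rcons p b); rewrite rcons_path pp pl last_rcons; split=> // x.
      rewrite mem_rcons inE => /orP [/eqP ->|/pi [j <-]]; first by exists 0.
      by exists j.+1; rewrite iterSr.
    (* Without an arc into [b] the chain stands still, and the path found for the shorter chain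
       serves. *)
    have Eb : pre b = b.
      move: neb; rewrite /pre; case: pickP => //= q qb; by rewrite qb.
    by rewrite Eb in pp pl pi; exists p.
  case=> p [pp pl pi]; case/shortenP: pp pl => p' pp' /= /andP [vp' up'] sp pl.
  by exists p'; split=> // x /sp /pi.
pose good b p := [/\ path e v p, last v p = b, uniq p, v \notin p &
  forall x, x \in p -> exists i, iter i pre b = x].
have /fin_all_exists [P HP] b : exists p, b \in B -> good b p.
  by case: (boolP (b \in B)) => [/chain_path [p Hp]|_]; [exists p | exists [::]].
rewrite {}/good in HP.
exists P; split=> [b /HP [] //|b b' bB b'B ne x xb].
have [_ _ _ vPb /(_ _ xb) [i Ei]] := HP _ bB.
apply/negP => xb'; have [_ _ _ _ /(_ _ xb') [j Ej]] := HP _ b'B.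
have : iter i pre b = v by apply: (chain_disjoint bB b'B ne (j := j)); rewrite Ei.
by rewrite Ei => xv; rewrite -xv xb in vPb.
Qed.

End Critical.

(** Arcs are deleted as long as the condition survives, by induction on their number. When every arc
    is critical, all indegrees are at most one, and the chains of predecessors from [B] back to [v]
    give the paths. *)
Theorem menger e v B :
  v \notin B ->
  (forall U, v \notin U -> B \subset U -> #|B| <= #|in_boundary e U|) ->
  exists P : T -> seq T,
    (forall b, b \in B ->
       [/\ path e v (P b), last v (P b) = b, uniq (P b) & v \notin P b])
    /\ {in B &, forall b b', b != b' -> forall x, x \in P b -> x \notin P b'}.
Proof.
move=> vB conn.
have {conn} : forall U, ~~ separates_less e v B U.
  move=> U; apply/and3P => -[vU BU]; have := conn _ vU BU; lia.
have [k] := ubnP #|[set xy : T * T | e xy.1 xy.2]|.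
elim: k e => // k IH e lek conn.
case: (pickP (fun pq : T * T => e pq.1 pq.2 &&
         [forall U, ~~ separates_less (delete_arc e pq.1 pq.2) v B U])) => /=.
  case=> p q /= /andP [pq /forallP del].
  have [|P [HP Hd]] := IH _ _ del.
    by have := num_delete_arc pq; lia.
  exists P; split=> // b bB; have [Hp ? ? ?] := HP _ bB; split=> //.
  by apply: sub_path Hp => x y /andP [].
move=> crit; apply: critical_linkage => // p q pq.
move: (crit (p, q)); rewrite /= pq /= => /negbT /forallPn [U].
by rewrite negbK; exists U.
Qed.

End InBoundary.

(** * Reachability avoiding two vertices *)

Section Reach.

Variables (V : finType) (e : rel V).

(** Only heads are tested, so that a walk may start at an avoided vertex: [reach v v v u] is about
    nonempty walks from [v] that never return to [v]. *)
Definition avoid (a b : V) : rel V := fun p q => [&& e p q, q != a & q != b].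

(* Locked, since [apply/negP] would otherwise look through the [exists]. *)
Definition reach s a b u : bool :=
  locked [exists x, avoid a b s x && connect (avoid a b) x u].

Lemma reachP s a b u :
  reflect (exists p, [/\ path (avoid a b) s p, p != [::] & last s p = u])
          (reach s a b u).
Proof.
rewrite /reach -lock; apply: (iffP existsP) => [[x /andP [sx /connectP [p pp ->]]]|].
  by exists (x :: p); rewrite /= sx.
case=> -[|x p] [] //= /andP [sx pp] _ Eu; exists x; rewrite sx /=.
by apply/connectP; exists p.
Qed.

Lemma reach_arc s a b u : avoid a b s u -> reach s a b u.
Proof. by move=> su; apply/reachP; exists [:: u]; rewrite /= su. Qed.

Lemma reach_step s a b u u' : reach s a b u -> avoid a b u u' -> reach s a b u'.
Proof.
case/reachP => p [pp _ lp] uu'; apply/reachP; exists (rcons p u').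
by rewrite rcons_path pp lp last_rcons -size_eq0 size_rcons.
Qed.

Lemma reach_ind s a b (P : V -> Prop) :
  (forall u, avoid a b s u -> P u) ->
  (forall u u', reach s a b u -> P u -> avoid a b u u' -> P u') ->
  forall u, reach s a b u -> P u.
Proof.
move=> P0 PS u /reachP [p [pp pn <-]] {u}.
elim/last_ind: p pp pn => // p y IH; rewrite rcons_path last_rcons.
move=> /andP [pp ly] _; case: p pp ly IH => [_ /P0 //|x p pp ly IH].
apply: (PS _ _ _ _ ly); last exact: IH.
by apply/reachP; exists (x :: p).
Qed.

Lemma reach_neq s a b u : reach s a b u -> (u != a) && (u != b).
Proof.
move: u; apply: reach_ind => [u /and3P [_ -> -> //]|u u' _ _ /and3P [_ -> -> //]].
Qed.

Lemma reach_weaken s a b u : reach s a b u -> reach s a a u.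
Proof.
move: u; apply: reach_ind => [u /and3P [su ua _]|u u' _ Hu /and3P [su ua _]].
  by apply: reach_arc; rewrite /avoid su ua.
by apply: reach_step Hu _; rewrite /avoid su ua.
Qed.

Lemma reach_swap s a b u : reach s a b u -> reach s b a u.
Proof.
move: u; apply: reach_ind => [u /and3P [su ua ub]|u u' _ Hu /and3P [su ua ub]].
  by apply: reach_arc; rewrite /avoid su ua ub.
by apply: reach_step Hu _; rewrite /avoid su ua ub.
Qed.

Lemma reach_path s a b x p : reach s a b x -> path e x p ->
  a \notin p -> b \notin p -> forall y, y \in p -> reach s a b y.
Proof.
elim: p x => // q p IH x rx /= /andP [xq qp]; rewrite !inE !negb_or.
move=> /andP [aq ap] /andP [bq bp] y.
have rq : reach s a b q by apply: reach_step rx _; rewrite /avoid xq ![q == _]eq_sym aq bq.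
by rewrite inE => /orP [/eqP -> //|]; exact: (IH q).
Qed.

Lemma path_reach s a b p : path e s p -> a \notin p -> b \notin p ->
  p != [::] -> reach s a b (last s p).
Proof.
move=> pp ap bp pn; apply/reachP; exists p; split=> //.
elim: p s {pn} pp ap bp => //= q p IH s /andP [xq qp]; rewrite !inE !negb_or.
move=> /andP [aq ap] /andP [bq bp]; by rewrite IH // /avoid xq ![q == _]eq_sym aq bq.
Qed.

(** A walk to [q] avoiding [w] must meet [a], for otherwise it would reach [q] avoiding [a]; its
    part up to [a] is the walk sought. *)
Lemma reach_trans_dom s a w q :
  reach s w w q -> ~~ reach s a a q -> reach s w w a.
Proof.
move=> rq; suff [-> //|//] : reach s a a q \/ reach s w w a.
move: q rq; apply: reach_ind => [u su|u u' ru [Hu|->] uu']; last by right.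
  have [Eu|ua] := eqVneq u a; first by right; rewrite -Eu; apply: reach_arc.
  by left; apply: reach_arc; move: su; rewrite /avoid ua => /and3P [->].
have [Eu|ua] := eqVneq u' a; first by right; rewrite -Eu; apply: reach_step uu'.
by left; apply: reach_step Hu _; move: uu'; rewrite /avoid ua => /and3P [->].
Qed.

(** Only the part of the walk after its last visit to [v] is kept. *)
Lemma reach_root v a b u : reach v a b u -> u != v -> reach v v v u.
Proof.
move=> ru uv; suff [Eu|//] : u = v \/ reach v v v u by rewrite Eu eqxx in uv.
move: u ru {uv}; apply: reach_ind => [u /and3P [vu _ _]|u u' _ Hu /and3P [uu' _ _]].
  have [|uv] := eqVneq u v; first by left.
  by right; apply: reach_arc; rewrite /avoid vu uv.
have [|uv] := eqVneq u' v; first by left.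
right; case: Hu => Hu; last by apply: reach_step Hu _; rewrite /avoid uu' uv.
by apply: reach_arc; rewrite /avoid -{1}Hu uu' uv.
Qed.

(** With [unreach_boundary] this translates separation from [v] by two vertices into sets with at
    most two entry vertices, to which submodularity applies. *)
Lemma reach_boundary v a b (U : {set V}) : v \notin U ->
  in_boundary e U \subset [set a; b] -> forall u, reach v a b u -> u \notin U.
Proof.
move=> vU /subsetP bd.
have enter p q : p \notin U -> avoid a b p q -> q \notin U.
  move=> pU /and3P [pq qa qb]; apply/negP => qU.
  have /bd : q \in in_boundary e U by apply/in_boundaryP; split=> //; exists p.
  by rewrite !inE (negbTE qa) (negbTE qb).
by apply: reach_ind => [u /enter|u u' _ /enter H /H]; apply.
Qed.

Lemma unreach_boundary v a b :
  in_boundary e [set u | (u != v) && ~~ reach v a b u] \subset [set a; b].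
Proof.
apply/subsetP => q /in_boundaryP [qU [p pU pq]]; rewrite !inE.
apply/norP => -[qa qb]; move: pU qU; rewrite !inE => pr /andP [_].
have {}pr : (p == v) || reach v a b p.
  by move: pr; case: eqVneq => //= _; case: (reach v a b p).
suff -> : reach v a b q by []; case/orP: pr => [/eqP pv|rp].
  by apply: reach_arc; rewrite /avoid -{1}pv pq qa qb.
by apply: reach_step rp _; rewrite /avoid pq qa qb.
Qed.

Lemma card_le2P (x0 : V) (X : {set V}) : #|X| <= 2 -> exists a b, X \subset [set a; b].
Proof.
case: (set_0Vmem X) => [-> _|[a aX]]; first by exists x0, x0; apply: sub0set.
rewrite (cardsD1 a X) aX /=; case: (set_0Vmem (X :\ a)) => [E _|[b bX]].
  exists a, a; apply/subsetP => c cX; rewrite !inE orbb.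
  by move/setP/(_ c): E; rewrite !inE cX andbT => /negbFE.
rewrite (cardsD1 b (X :\ a)) bX => le; exists a, b; apply/subsetP => c cX.
have /eqP/cards0_eq/setP/(_ c) : #|X :\ a :\ b| == 0 by lia.
by rewrite !inE cX andbT => /negbT; rewrite -negb_or negbK orbC.
Qed.

Definition linked v w x z :=
  [forall a, forall b, [|| reach v a b w, reach v a b x | reach v a b z]].

Lemma linkedP v w x z a b : linked v w x z ->
  [\/ reach v a b w, reach v a b x | reach v a b z].
Proof. by move=> /forallP /(_ a) /forallP /(_ b) /or3P. Qed.

Lemma linked_connectivity v w x z (U : {set V}) : linked v w x z ->
  v \notin U -> [set w; x; z] \subset U -> 2 < #|in_boundary e U|.
Proof.
move=> lk vU /subsetP BU; rewrite ltnNge; apply/negP => /(card_le2P v) [a [b sub]].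
by case: (linkedP a b lk) => /(reach_boundary vU sub) /negP []; apply: BU;
  rewrite !inE eqxx ?orbT.
Qed.

End Reach.

(** * A criterion for W_3-subdivisions *)

Section Wheel.

Variables (V : finType) (e : rel V).

Local Notation reach := (reach e).
Local Notation linked := (linked e).

(* [p i] is the end on [C] of the spoke with internal vertices [Q i]. *)
Definition spoked_cycle (v : V) (C : seq V) (p : 'I_3 -> V) (Q : 'I_3 -> seq V) :=
  [/\ [/\ uniq C, cycle e C, v \notin C & injective p],
      forall i, [/\ p i \in C, path e v (rcons (Q i) (p i)), uniq (Q i) & v \notin Q i],
      forall i x, x \in Q i -> x \notin C
    & forall i j x, x \in Q i -> x \in Q j -> i = j].

Section Spokes.

Variables (v w x z : V) (C : seq V).
Hypotheses (wxz : linked v w x z) (C_uniq : uniq C) (C_cycle : cycle e C).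
Hypotheses (vC : v \notin C) (wC : w \in C) (xC : x \in C) (zC : z \in C).
Hypotheses (wx_neq : w != x) (xz_neq : x != z) (wz_neq : w != z).

(** Menger's theorem gives disjoint paths to [w], [x], [z], and each is cut at its first vertex on
    [C]. The spokes may thus end elsewhere than at these three vertices. *)
Lemma linked_spokes : exists p Q, spoked_cycle v C p Q.
Proof.
pose B := [set w; x; z].
have BC b : b \in B -> b \in C by rewrite !inE => /orP [/orP []|] /eqP ->.
have cardB : #|B| = 3.
  by rewrite /B setUC cardsU1 cards2 !inE wx_neq eq_sym (negbTE wz_neq) eq_sym (negbTE xz_neq).
have vB : v \notin B by apply: contra vC => /BC.
have [|P [HP Hd]] := @menger _ e v B vB.
  by move=> U vU BU; rewrite cardB; apply: linked_connectivity wxz vU BU.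
(* [r b] splits [P b] at its first vertex on [C]: the part before, the vertex, the rest. *)
have /fin_all_exists [r Hr] b : exists r : seq V * V * seq V, b \in B ->
    [/\ P b = rcons r.1.1 r.1.2 ++ r.2, r.1.2 \in C & forall y, y \in r.1.1 -> y \notin C].
  have [bB|_] := boolP (b \in B); last by exists ([::], v, [::]).
  have [_ Pl _ _] := HP _ bB.
  have hasC : has (mem C) (P b).
    apply/hasP; exists b; last exact: BC.
    case: (P b) Pl => [|y s] /= Ev; last by rewrite -Ev mem_last.
    by rewrite Ev bB in vB.
  case: (split_find hasC) => y s1 s2 yC sC; exists (s1, y, s2) => _; split=> //= u us.
  by apply: contra sC => uC; apply/hasP; exists u.
pose b := tnth [tuple w; x; z].
have bB i : b i \in B.
  by have := mem_tnth i [tuple w; x; z]; rewrite !inE orbA.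
have b_inj : injective b.
  by apply/tuple_uniqP; rewrite /= !inE negb_or wx_neq wz_neq xz_neq.
pose p i := (r (b i)).1.2; pose Q i := (r (b i)).1.1.
have PE i : P (b i) = rcons (Q i) (p i) ++ (r (b i)).2 by case: (Hr _ (bB i)).
have disj i j y : y \in rcons (Q i) (p i) -> y \in rcons (Q j) (p j) -> i = j.
  move=> yi yj; apply/b_inj/eqP/negPn/negP => ne.
  have := Hd _ _ (bB i) (bB j) ne y; rewrite !PE !mem_cat yi yj /=.
  by move/(_ isT).
exists p, Q; split; first split=> //.
- by move=> i j Eij; apply: (disj _ _ (p i)); rewrite ?Eij mem_rcons mem_head.
- move=> i; have [pp _ Pu vP] := HP _ (bB i); have [_ piC _] := Hr _ (bB i).
  move: pp Pu vP; rewrite PE cat_path cat_uniq mem_cat mem_rcons rcons_uniq inE.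
  by rewrite !negb_or => /andP [-> _] /andP [/andP [_ ->] _] /andP [/andP [_ ->]].
- by move=> i y; have [_ _] := Hr _ (bB i); apply.
- by move=> i j y yi yj; apply: (disj _ _ y); rewrite mem_rcons inE ?yi ?yj orbT.
Qed.

End Spokes.

(** Domination in the flow graph with root [v]. Reachability is built in, so that [v] itself
    dominates nothing. *)
Definition dominated v w u := reach v v v u && ~~ reach v w w u.

Lemma dominated_enter v w p q : dominated v w q -> q != w -> e p q ->
  reach v v v p -> dominated v w p.
Proof.
move=> /andP [_ nq] qw pq rp; rewrite /dominated rp /=; apply: contra nq => rwp.
by apply: reach_step rwp _; rewrite /avoid pq qw.
Qed.

(** By [dominated_enter], a walk from [v] to [y] can enter the region dominated by [w] only at [w];
    after its last visit to [w] it stays in the region. *)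
Lemma dominated_path v w y : dominated v w y ->
  exists s, [/\ path e w s, last w s = y & forall u, u \in s -> dominated v w u].
Proof.
move=> dy; have /andP [ry _] := dy.
pose P u := dominated v w u ->
  exists s, [/\ path e w s, last w s = u & forall u, u \in s -> dominated v w u].
suff : P y by apply.
move: y ry {dy}; apply: reach_ind => [u /and3P [vu uv _]|u u' ru IH /and3P [uu' uv _]].
  (* An out-neighbour of [v] dominated by [w] is [w] itself. *)
  case/andP => _ nu; exists [::]; split=> //=; apply/esym/eqP.
  by apply: contraNT nu => uw; apply: reach_arc; rewrite /avoid vu uw.
move=> du'; have [->|uw] := eqVneq u' w; first by exists [::].
have [s [ps ls ds]] := IH (dominated_enter du' uw uu' ru).
exists (rcons s u'); rewrite rcons_path ps ls last_rcons; split=> // t.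
by rewrite mem_rcons inE => /orP [/eqP ->|/ds].
Qed.

Lemma dominated_uniq_path v w y : dominated v w w -> dominated v w y ->
  exists s, [/\ path e w s, uniq (w :: s), last w s = y &
    forall u, u \in w :: s -> dominated v w u].
Proof.
move=> dw /dominated_path [s0 [ps ls ds]]; case/shortenP: ps ls => s ps us ss ls.
by exists s; split=> // u; rewrite inE => /orP [/eqP ->|/ss /ds].
Qed.

Lemma not_dominated_path v w z s : reach v v v z -> ~~ dominated v w z ->
  path e z s -> v \notin s -> w \notin s -> forall u, u \in s -> ~~ dominated v w u.
Proof.
elim: s z => // y s IH z rz dz /= /andP [zy ys]; rewrite !inE !negb_or.
move=> /andP [vy vs] /andP [wy ws].
have ry : reach v v v y by apply: reach_step rz _; rewrite /avoid zy eq_sym vy.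
have dy : ~~ dominated v w y.
  by apply: contra dz => dy; apply: dominated_enter dy _ zy rz; rewrite eq_sym.
by move=> u; rewrite inE => /orP [/eqP -> //|]; apply: (IH y).
Qed.

(* For an undominated [x], this says that [w] reaches [x] through vertices
   dominated by [w]. *)
Definition jump v w x := [exists y, e y x && dominated v w y].

Definition wheel_test := [exists v, exists w, exists x, exists z,
  [&& jump v w x, jump v x z, reach z v x w, z != v & linked v w x z]].

(** Suppose both dominate [u]. The path from [x] to [u] inside the region of [x] misses [w], and it
    starts outside the region of [w], which it can therefore never enter. *)
Lemma dominated_disjoint v w x u :
  dominated v w w -> dominated v x x -> reach v x x w -> reach v w w x ->
  dominated v w u -> ~~ dominated v x u.
Proof.
move=> dw dx rw rx du; apply/negP => /dominated_path [s [ps ls ds]].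
have nx : ~~ dominated v w x by rewrite /dominated rx andbF.
have [us|us] := boolP (w \in s).
  by have := ds _ us; rewrite /dominated rw andbF.
have vs : v \notin s.
  by apply/negP => /ds /andP [/reach_neq]; rewrite eqxx.
have /andP [rvx _] := dx.
case: s ps ls us vs {ds} => [_ /= xu|y s ps ls us vs].
  by rewrite xu du in nx.
have := not_dominated_path rvx nx ps vs us (u := u).
by rewrite -ls /= mem_last => /(_ isT); rewrite [last _ _]ls du.
Qed.

Lemma spoked_of_test : wheel_test -> exists v C p Q, spoked_cycle v C p Q.
Proof.
case/existsP => v /existsP [w /existsP [x /existsP [z]]].
case/and5P => /existsP [y /andP [yx dy]] /existsP [y' /andP [y'z dy']] rzw zv wxz.
have self a b : reach v a b a = false by apply/negP => /reach_neq; rewrite eqxx.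
have self' a b : reach v a b b = false by apply/negP => /reach_neq; rewrite eqxx andbF.
have wv : w != v by apply: contraTneq dy => ->; rewrite /dominated andbN.
have xv : x != v by apply: contraTneq dy' => ->; rewrite /dominated andbN.
(* Deleting two of three linked vertices leaves the third reachable; this yields that they are
   distinct and that none dominates another. *)
have rw : reach v x z w by case: (linkedP x z wxz); rewrite ?self ?self'.
have rx : reach v w z x by case: (linkedP w z wxz); rewrite ?self ?self'.
have rz : reach v w x z by case: (linkedP w x wxz); rewrite ?self ?self'.
have dw : dominated v w w by rewrite /dominated (reach_root rw wv) self.
have dx : dominated v x x by rewrite /dominated (reach_root rx xv) self.
have nzw : ~~ dominated v w z by rewrite /dominated (reach_weaken rz) andbF.
have nzx : ~~ dominated v x z by rewrite /dominated (reach_weaken (reach_swap rz)) andbF.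
have rvz := reach_root rz zv.
have wx_neq : w != x by case/andP: (reach_neq rw).
have wz_neq : w != z by case/andP: (reach_neq rw).
have xz_neq : x != z by case/andP: (reach_neq rx).
have [s1 [ps1 us1 ls1 ds1]] := dominated_uniq_path dw dy.
have [s2 [ps2 us2 ls2 ds2]] := dominated_uniq_path dx dy'.
have [s [ps' sn ls]] := reachP _ _ _ _ _ rzw.
have [ps vs xs] : [/\ path e z s, v \notin s & x \notin s].
  elim: s z {sn ls} ps' {zv wxz rz nzw nzx rvz wz_neq xz_neq y'z rzw rw rx} => //= a s IH z.
  by case/andP => /and3P [-> av ax] /IH [-> vs xs]; rewrite !inE !negb_or
    [v == a]eq_sym av [x == a]eq_sym ax.
case/shortenP: ps ls => s3 ps3 us3 ss3 ls3.
have vs3 : v \notin s3 by apply: contra vs => /ss3.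
have xs3 : x \notin s3 by apply: contra xs => /ss3.
(* The final [w] of the walk is split off, since the cycle already starts with it. *)
case/lastP: s3 ls3 ps3 us3 {ss3 vs xs} vs3 xs3 => [/= Ezw|s3 w']; first by rewrite Ezw eqxx in wz_neq.
rewrite last_rcons => ->; rewrite rcons_path -rcons_cons rcons_uniq.
case/andP => ps3 ls3 /andP [ws3 us3]; rewrite !mem_rcons !inE !negb_or.
case/andP => _ vs /andP [_ xs].
have ds3w u : u \in z :: s3 -> ~~ dominated v w u.
  rewrite inE => /orP [/eqP -> //|]; apply: not_dominated_path ps3 vs _ _ => //.
  by move: ws3; rewrite inE negb_or => /andP [].
have ds3x u : u \in z :: s3 -> ~~ dominated v x u.
  by rewrite inE => /orP [/eqP -> //|]; apply: not_dominated_path ps3 vs xs _.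
exists v, ((w :: s1) ++ (x :: s2) ++ (z :: s3)).
apply: (linked_spokes wxz) => //.
- rewrite cat_uniq us1 andTb; apply/andP; split.
    apply/hasPn => u us; apply/negP => /ds1 du.
    move: us; rewrite mem_cat => /orP [/ds2|/ds3w]; last by rewrite du.
    by apply/negP; apply: dominated_disjoint dw dx _ _ du;
      apply: reach_weaken; [exact: rw|exact: rx].
  rewrite cat_uniq us2 us3 andTb andbT; apply/hasPn => u us.
  by apply/negP => /ds2; apply/negP; apply: ds3x.
- rewrite /= rcons_cat cat_path ps1 ls1 /= yx rcons_cat cat_path ps2 ls2 /= y'z.
  by rewrite rcons_path ps3.
- apply/negP; rewrite !mem_cat => /or3P [/ds1|/ds2|].
  + by case/andP => /reach_neq; rewrite eqxx.
  + by case/andP => /reach_neq; rewrite eqxx.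
  + by rewrite inE eq_sym (negbTE zv) (negbTE vs).
- by rewrite mem_head.
- by rewrite mem_cat mem_head orbT.
- by rewrite !mem_cat mem_head !orbT.
Qed.

End Wheel.

(** * Necessity of the criterion *)

Section Necessity.

Variables (V : finType) (e : rel V) (v : V).

Local Notation reach := (reach e).
Local Notation linked := (linked e).
Local Notation dominated := (dominated e).

(** The choice of [v] for [a] makes reachability from [v] part of the condition. *)
Definition undominated u := (u != v) && [forall a, (a == u) || reach v a a u].

Lemma undominatedP u a : undominated u -> a != u -> reach v a a u.
Proof. by case/andP => _ /forallP /(_ a) /orP [->|]. Qed.

(* The two dominating sets meet in a set containing [p] and [q], which has at
   least two entry vertices; submodularity leaves at most two for their union. *)
Lemma uncross p q a b a' b' : undominated p -> undominated q -> p != q ->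
  ~~ reach v a b p -> ~~ reach v a b q -> ~~ reach v a' b' p -> ~~ reach v a' b' q ->
  exists a2 b2, forall u, u != v -> ~~ reach v a b u || ~~ reach v a' b' u ->
    ~~ reach v a2 b2 u.
Proof.
move=> Ip Iq pq pU qU pW qW.
pose U := [set u | (u != v) && ~~ reach v a b u].
pose W := [set u | (u != v) && ~~ reach v a' b' u].
have vU : v \notin U by rewrite inE eqxx.
have vW : v \notin W by rewrite inE eqxx.
have pv : p != v by case/andP: Ip.
have qv : q != v by case/andP: Iq.
have cardU c d : #|in_boundary e [set u | (u != v) && ~~ reach v c d u]| <= 2.
  apply: leq_trans (subset_leq_card (unreach_boundary _ _ _ _)) _.
  by rewrite cards2; case: (c != d).
(* If the intersection had at most one entry vertex [c], then [c] would separate [p] and [q] from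
   [v]; both being undominated, they would equal [c]. *)
have cap2 : 1 < #|in_boundary e (U :&: W)|.
  rewrite ltnNge; apply/negP => le1.
  have [c sub] : exists c, in_boundary e (U :&: W) \subset [set c; c].
    case: (set_0Vmem (in_boundary e (U :&: W))) => [->|[c cX]].
      by exists v; apply: sub0set.
    exists c; apply/subsetP => d dX; rewrite !inE orbb.
    by move/card_le1_eqP: le1 => /(_ _ _ cX dX) ->.
  have vUW : v \notin U :&: W by rewrite inE negb_and vU.
  have nr r : r \in U :&: W -> undominated r -> r = c.
    move=> rUW Ir; apply/eqP; apply: contraTT rUW => rc.
    by apply: (reach_boundary vUW sub); apply: undominatedP => //; rewrite eq_sym.
  have Ep : p = c by apply: nr => //; rewrite !inE pv pU pW.
  have Eq : q = c by apply: nr => //; rewrite !inE qv qU qW.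
  by rewrite Ep Eq eqxx in pq.
have cup2 : #|in_boundary e (U :|: W)| <= 2.
  move: (in_boundary_submod e U W) cap2 (cardU a b) (cardU a' b').
  by rewrite -/U -/W; clear; lia.
have [a2 [b2 sub]] := card_le2P v cup2; exists a2, b2 => u uv uUW.
apply: contraL (uUW) => /(reach_boundary _ sub).
by rewrite !inE eqxx => /(_ isT); rewrite uv.
Qed.

(** Induction along the list. If the first triple is not linked, its separating pair and the pair
    for the tail both cut off the second and third vertex, so [uncross] merges them into one pair
    for the whole list. Lists of length at most two are separated by their own elements. *)
Lemma linked_or_flat s : uniq s -> all undominated s ->
  (exists l1 w x z l2, s = l1 ++ [:: w, x, z & l2] /\ linked v w x z) \/
  (exists a b, all (fun u => ~~ reach v a b u) s).
Proof.
have self a b : reach v a b a = false by apply/negP => /reach_neq; rewrite eqxx.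
have self' a b : reach v a b b = false by apply/negP => /reach_neq; rewrite eqxx andbF.
elim: s => [|w [|x [|z s]] IH]; first by right; exists v, v.
- by right; exists w, w; rewrite /= self.
- by right; exists w, x; rewrite /= self self'.
case/andP => ws us /andP [Iw Is].
have allI : all undominated [:: x, z & s] := Is.
case: (IH us Is) => [[l1 [w1 [x1 [z1 [l2 [-> lk]]]]]]|].
  by left; exists (w :: l1), w1, x1, z1, l2.
case=> a [b allab]; case: (boolP (linked v w x z)) => [lk|].
  by left; exists [::], w, x, z, s.
case/forallPn => a' /forallPn [b']; rewrite !negb_or => /and3P [nw nx nz].
have /and3P [Ix Iz _] := Is; have /and3P [nx' nz' _] := allab.
have xz : x != z by move: us => /= /andP []; rewrite inE negb_or => /andP [].
have [a2 [b2 H]] := uncross Ix Iz xz nx' nz' nx nz.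
right; exists a2, b2; apply/allP => u; rewrite inE => /orP [/eqP ->|us'].
  by apply: H; [case/andP: Iw | rewrite nw orbT].
apply: H; first by have /andP [] := allP allI u us'.
by rewrite (allP allab).
Qed.

Lemma filter_eq_cat_cons (T : eqType) (a : pred T) (s l1 l2 : seq T) x :
  filter a s = l1 ++ x :: l2 ->
  exists s1 s2, [/\ s = s1 ++ x :: s2, filter a s1 = l1 & filter a s2 = l2].
Proof.
elim: s l1 => [|y s IH] l1 /=; first by case: l1.
case: ifP => ay; last first.
  by case/IH => s1 [s2 [-> <- <-]]; exists (y :: s1), s2; rewrite /= ay.
case: l1 => [[-> Es]|z l1 [Ez /IH [s1 [s2 [-> <- <-]]]]]; first by exists [::], s.
by exists (y :: s1), s2; rewrite /= ay Ez.
Qed.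

(** Going along [s], suppose that a vertex [q] is reachable avoiding [w]. Some other [a] separates
    [q] from [v] and is itself reachable avoiding [w], so it is neither [w] nor an earlier vertex of
    the segment. But then going to [w] and along the segment reaches [q] without [a]. *)
Lemma jump_segment w s x : undominated w -> path e w (rcons s x) -> v \notin s ->
  filter undominated s = [::] -> jump e v w x.
Proof.
move=> Iw; rewrite rcons_path => /andP [ps lx] vs Is.
have wv : w != v by case/andP: Iw.
have rw : reach v v v w by apply: undominatedP; rewrite // eq_sym.
suff dom : forall u, u \in w :: s -> dominated v w u.
  by apply/existsP; exists (last w s); rewrite lx dom // mem_last.
have self u : u == w -> dominated v w u.
  by move/eqP => ->; rewrite /dominated rw; apply/negP => /reach_neq; rewrite eqxx.
elim/last_ind: s {x lx} ps vs Is => [|s q IH]; first by move=> _ _ _ u; rewrite mem_seq1; apply: self.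
rewrite rcons_path mem_rcons inE negb_or filter_rcons => /andP [ps lq] /andP [vq vs].
case: ifP => [_|nIq Is]; first by case: (filter _ _).
have {}IH := IH ps vs Is.
move=> u; rewrite -rcons_cons mem_rcons inE => /orP [/eqP -> {u}|]; last exact: IH.
have rq : reach v v v q.
  apply: (reach_path rw (p := rcons s q)); rewrite ?mem_rcons ?mem_head ?inE ?negb_or ?vq //.
  by rewrite rcons_path ps.
rewrite /dominated rq /=; apply/negP => rwq.
move: nIq; rewrite /undominated eq_sym vq /= => /negbT /forallPn [a].
rewrite negb_or => /andP [aq naq].
have raw := reach_trans_dom rwq naq.
have [aw|aw] := eqVneq a w; first by have := reach_neq raw; rewrite aw eqxx.
have a_notin : a \notin s.
  by apply/negP => ins; have := IH a; rewrite inE ins orbT /dominated raw andbF => /(_ isT).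
case/negP: naq; apply: (reach_path (undominatedP Iw aw) (p := rcons s q));
  rewrite ?mem_rcons ?mem_head ?inE ?negb_or ?aq ?a_notin //.
by rewrite rcons_path ps.
Qed.

Section Spoked.

Variables (C : seq V) (p : 'I_3 -> V) (Q : 'I_3 -> seq V).
Hypothesis spoked : spoked_cycle e v C p Q.

Let p_in_C i : p i \in C. Proof. by case: spoked => _ /(_ i) []. Qed.

Let disj i j y : y \in rcons (Q i) (p i) -> y \in rcons (Q j) (p j) -> i = j.
Proof.
case: spoked => -[_ _ _ p_inj] _ QC Qd.
rewrite !mem_rcons !inE => /orP [/eqP ->|yi] /orP [/eqP|].
- exact: p_inj.
- by move/QC; rewrite p_in_C.
- by move=> Ey; move: (QC _ _ yi); rewrite Ey p_in_C.
- exact: Qd.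
Qed.

Let spoke_reach i a b : a \notin rcons (Q i) (p i) -> b \notin rcons (Q i) (p i) ->
  reach v a b (p i).
Proof.
move=> ai bi; case: spoked => _ /(_ i) [_ pp _ _] _ _.
by have := path_reach pp ai bi; rewrite last_rcons; apply; case: (Q i).
Qed.

Let cycle_reach a x y : a \notin C -> x \in C -> y \in C ->
  reach v a a x -> reach v a a y.
Proof.
move=> aC xC yC rx; case: spoked => -[uC cC _ _] _ _ _.
have [i s Es] := rot_to xC; have := cC; rewrite -(rot_cycle i) Es /= => ps.
have ya : y \in rcons s x by rewrite mem_rcons -Es mem_rot.
have a_notin : a \notin rcons s x.
  by rewrite mem_rcons -Es mem_rot.
exact: (reach_path rx ps a_notin a_notin ya).
Qed.

(** A vertex [a] off the spoke to [p i] is avoided by that spoke. If [a] lies inside the spoke, it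
    is avoided by another spoke followed by a stretch of [C]. *)
Let p_undominated i : undominated (p i).
Proof.
have vC : v \notin C by case: spoked => -[].
apply/andP; split; first by apply: contraNneq vC => <-.
apply/forallP => a; case: eqVneq => //= ap.
have [aQ|aQ] := boolP (a \in Q i); last first.
  by apply: spoke_reach; rewrite mem_rcons inE negb_or ap.
have aC : a \notin C by case: spoked => _ _ H _; apply: H aQ.
have ne : i != ordS i by case: (i) => -[|[|[|]]].
apply: (cycle_reach aC (p_in_C (ordS i))) => //.
by apply: spoke_reach; apply/negP => /(disj (i := i)); rewrite mem_rcons inE aQ orbT
  => /(_ isT) Ei; rewrite -Ei eqxx in ne.
Qed.

Lemma test_of_spoked : wheel_test e.
Proof.
have [[uC cC vC p_inj] _ _ _] := spoked.
have [] := @linked_or_flat (filter undominated C).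
- exact: filter_uniq.
- exact: filter_all.
- case=> l1 [w [x [z [l2 [Ef lk]]]]].
  have /allP all_un := filter_all undominated C; rewrite Ef in all_un.
  have Iw : undominated w by apply: all_un; rewrite mem_cat mem_head orbT.
  have Ix : undominated x by apply: all_un; rewrite mem_cat !inE eqxx !orbT.
  (* [A2] and [A3] are the stretches of [C] from [w] to [x] and from [x] to [z], free of undominated
     vertices; [A4] and [A1] together lead from [z] round to [w]. *)
  have [A1 [s1 [EC _ /(filter_eq_cat_cons (l1 := [::])) [A2 [s2 [Es1 F2 ]]]]]] :=
    filter_eq_cat_cons Ef.
  move=> /(filter_eq_cat_cons (l1 := [::])) [A3 [A4 [Es2 F3 _]]].
  subst s1 s2; pose A := A4 ++ A1.
  have EA : (w :: A2 ++ x :: A3 ++ z :: A4) ++ A1 = w :: A2 ++ x :: A3 ++ z :: A.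
    by rewrite /A /= -!catA /= -catA.
  have cA : cycle e (w :: A2 ++ x :: A3 ++ z :: A) by rewrite -EA -cycle_catC -EC.
  have uA : uniq (w :: A2 ++ x :: A3 ++ z :: A) by rewrite -EA uniq_catC -EC.
  have vA : v \notin w :: A2 ++ x :: A3 ++ z :: A.
    by rewrite -EA mem_cat orbC -mem_cat -EC.
  have IA2 u : u \in A2 -> u != v.
    by move=> uA2; apply: contraNneq vA => <-; rewrite inE mem_cat uA2 orbT.
  have IA3 u : u \in A3 -> u != v.
    by move=> uA3; apply: contraNneq vA => <-; rewrite inE !(mem_cat, inE) uA3 !orbT.
  move: cA; rewrite /= rcons_cat rcons_cons rcons_cat rcons_cons cat_path /=.
  rewrite cat_path /= => /and5P [pA2 lA2 pA3 lA3 pA].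
  apply/existsP; exists v; apply/existsP; exists w; apply/existsP; exists x.
  apply/existsP; exists z; apply/and5P; split=> //.
  - apply: jump_segment Iw _ _ F2; first by rewrite rcons_path pA2.
    by apply/negP => /IA2; rewrite eqxx.
  - apply: jump_segment Ix _ _ F3; first by rewrite rcons_path pA3.
    by apply/negP => /IA3; rewrite eqxx.
  - have := path_reach (a := v) (b := x) pA; rewrite last_rcons; apply.
    + apply: contra vA; rewrite mem_rcons !(inE, mem_cat).
      by case/orP => ->; rewrite ?orbT.
    + move: uA; rewrite cons_uniq cat_uniq [uniq (x :: _)]cons_uniq !(inE, mem_cat, mem_rcons) !negb_or.
      by case/andP => /and5P [_ wx _ _ _] /and4P [_ _ /and3P [_ _ ->] _]; rewrite eq_sym wx.
    + by case: (A).
  - by apply: contraNneq vA => <-; rewrite !(inE, mem_cat) eqxx !orbT.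
(* A pair separating all undominated vertices of [C] would have to meet all three spokes, which are
   disjoint outside [v]. *)
case=> a [b /allP ab].
have hit i : (a \in rcons (Q i) (p i)) || (b \in rcons (Q i) (p i)).
  apply: contraT; rewrite negb_or => /andP [ai bi].
  have := ab (p i); rewrite mem_filter p_undominated p_in_C spoke_reach //.
  by move/(_ isT).
pose i0 := @Ordinal 3 0 isT; pose i1 := @Ordinal 3 1 isT; pose i2 := @Ordinal 3 2 isT.
have n01 : i0 <> i1 by [].
have n02 : i0 <> i2 by [].
have n12 : i1 <> i2 by [].
by case/orP: (hit i0) => h0; case/orP: (hit i1) => h1; case/orP: (hit i2) => h2;
  first [case: n01; apply: disj h0 h1 | case: n02; apply: disj h0 h2
        | case: n12; apply: disj h1 h2].
Qed.

End Spoked.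
End Necessity.

Lemma ord3P (P : 'I_3 -> Prop) :
  P (@Ordinal 3 0 isT) -> P (@Ordinal 3 1 isT) -> P (@Ordinal 3 2 isT) -> forall i, P i.
Proof.
move=> P0 P1 P2 [[|[|[|//]]] lt3].
- by rewrite (_ : Ordinal _ = Ordinal (isT : 0 < 3)) //; apply: val_inj.
- by rewrite (_ : Ordinal _ = Ordinal (isT : 1 < 3)) //; apply: val_inj.
- by rewrite (_ : Ordinal _ = Ordinal (isT : 2 < 3)) //; apply: val_inj.
Qed.

(** * Spoked cycles and subdivisions of the wheel *)

Section SpokedW3.

Variable D : digraph.
Local Notation e := (@arc D).
Local Notation i0 := (@Ordinal 3 0 isT).
Local Notation i1 := (@Ordinal 3 1 isT).
Local Notation i2 := (@Ordinal 3 2 isT).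

(** A cycle cut at the three spoke ends; [R i] becomes the path replacing the rim arc from [i] to
    [ordS i]. *)
Let rim (p : 'I_3 -> D) (R : 'I_3 -> seq D) :=
  (p i0 :: R i0) ++ (p i1 :: R i1) ++ (p i2 :: R i2).

Let mem_rim p R x : x \in rim p R -> exists i, x \in p i :: R i.
Proof.
by rewrite /rim !mem_cat => /or3P []; [exists i0 | exists i1 | exists i2].
Qed.

Let rim_mem p R i x : x \in p i :: R i -> x \in rim p R.
Proof. by move: i; apply: ord3P; rewrite /rim !mem_cat => ->; rewrite ?orbT. Qed.

Let rim_uniq p R : (forall i, uniq (p i :: R i)) ->
  (forall i j x, x \in p i :: R i -> x \in p j :: R j -> i = j) -> uniq (rim p R).
Proof.
move=> u d; rewrite /rim !cat_uniq !u andbT.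
have dis i j : i != j -> ~~ has [in p i :: R i] (p j :: R j).
  by move=> ne; apply/hasPn => x xj; apply: contraNN ne => /d /(_ xj) ->.
rewrite has_cat negb_or !dis //.
Qed.

Let rim_disj p R : uniq (rim p R) -> (forall i, uniq (p i :: R i)) /\
  (forall i j x, x \in p i :: R i -> x \in p j :: R j -> i = j).
Proof.
move=> u; split.
  by move: u; rewrite /rim !cat_uniq => /and3P [u0 _ /and3P [u1 _ u2]]; apply: ord3P.
(* Without repetitions in [rim p R], the occurrences of [x] in the three segments add up to at most
   one. *)
have cnt x : \sum_(i < 3) count_mem x (p i :: R i) <= 1.
  rewrite !big_ord_recr big_ord0 /=.
  have := count_uniq_mem x u; rewrite /rim !count_cat.
  rewrite (_ : widen_ord _ _ = i0); last exact: val_inj.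
  rewrite (_ : widen_ord _ ord_max = i1); last exact: val_inj.
  rewrite (_ : ord_max = i2); last exact: val_inj.
  rewrite /=; case: (_ \in _) => /=; lia.
move=> i j x xi xj; apply/eqP/negPn/negP => ne; have := cnt x.
rewrite (bigD1 i) // (bigD1 j) 1?eq_sym // -[X in X -> _]/(is_true (_ + (_ + _) <= 1)).
have c k : x \in p k :: R k -> 0 < count_mem x (p k :: R k).
  by rewrite -has_count has_pred1.
have := c i xi; have := c j xj.
lia.
Qed.

Let rim_cycle p R : cycle e (rim p R) <->
  forall i, path e (p i) (rcons (R i) (p (ordS i))).
Proof.
have E0 : ordS i0 = i1 by apply: val_inj.
have E1 : ordS i1 = i2 by apply: val_inj.
have E2 : ordS i2 = i0 by apply: val_inj.
rewrite /rim /= !rcons_cat /= !cat_path /= rcons_cat cat_path /=.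
split=> [/and5P [c0 l0 c1 l1 c2]|H].
  by apply: ord3P; rewrite ?E0 ?E1 ?E2 ?rcons_path ?c0 ?c1 ?l0 // -rcons_path.
have := H i0; have := H i1; have := H i2; rewrite E0 E1 E2 !rcons_path.
by move=> /andP [-> ->] /andP [-> ->] /andP [-> ->].
Qed.

Lemma spoked_of_W3 : contains_subdivision W3 D ->
  exists v C p Q, spoked_cycle e v C p Q.
Proof.
case/contains_subdivisionP => phi [P [phi_inj Pu Pphi Pdisj Ppath]].
pose p (i : 'I_3) := phi (Some i).
pose Q (i : 'I_3) := P None (Some i); pose R (i : 'I_3) := P (Some i) (Some (ordS i)).
have aR (i : 'I_3) : @arc W3 (Some i) (Some (ordS i)) by rewrite /= eqxx.
have aQ (i : 'I_3) : @arc W3 None (Some i) by [].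
have nphi a b x c : @arc W3 a b -> x \in P a b -> x != phi c.
  by move=> ab /(Pphi _ _ ab); apply: contraNneq => ->; apply: codom_f.
have p_inj : injective p by move=> i j /phi_inj [].
have inC i : p i \in rim p R by apply: (@rim_mem p R i); rewrite mem_head.
exists (phi None), (rim p R), p, Q; split.
- split=> //.
  + apply: rim_uniq.
      move=> i; rewrite /= Pu // andbT; apply/negP => /(nphi _ _ _ (Some i) (aR i)).
      by rewrite eqxx.
    move=> i j x; rewrite !inE => /orP [/eqP ->|xi] /orP [/eqP|xj].
    * exact: p_inj.
    * by have := nphi _ _ _ (Some i) (aR j) xj; rewrite eqxx.
    * by move=> Ex; have := nphi _ _ _ (Some j) (aR i) xi; rewrite Ex eqxx.
    * by case: (Pdisj _ _ _ _ (aR i) (aR j) x xi xj).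
  + by apply/rim_cycle => i; apply: Ppath.
  + apply/negP => /mem_rim [i]; rewrite inE => /orP [/eqP /phi_inj //|].
    by move/(nphi _ _ _ None (aR i)); rewrite eqxx.
- move=> i; split=> //; [exact: Ppath|exact: Pu|].
  by apply/negP => /(nphi _ _ _ None (aQ i)); rewrite eqxx.
- move=> i x xQ; apply/negP => /mem_rim [j]; rewrite inE => /orP [/eqP Ex|xR].
    by have := nphi _ _ _ (Some j) (aQ i) xQ; rewrite Ex eqxx.
  by have := Pdisj _ _ _ _ (aQ i) (aR j) x xQ xR.
- by move=> i j x xi xj; case: (Pdisj _ _ _ _ (aQ i) (aQ j) x xi xj).
Qed.

Let W3_of_rim v p Q R : spoked_cycle e v (rim p R) p Q -> contains_subdivision W3 D.
Proof.
case=> -[uC cC vC p_inj] HQ QC Qd.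
have [Ru Rd] := rim_disj uC; have /rim_cycle Rp := cC.
pose phi (o : W3) := if o is Some i then p i else v.
pose P (a b : W3) := match a, b with
  | None, Some i => Q i | Some i, Some _ => R i | _, _ => [::] end.
have RC i x : x \in R i -> x \in rim p R.
  by move=> xR; apply: (@rim_mem p R i); rewrite inE xR orbT.
have pC i : p i \in rim p R by case: (HQ i).
apply/contains_subdivisionP; exists phi, P; split.
- move=> [i|] [j|] //=; first by move/p_inj ->.
  + by move=> Ev; rewrite -Ev pC in vC.
  + by move=> Ev; rewrite Ev pC in vC.
- by move=> [i|] [j|] //= _; [case/andP: (Ru i) | case: (HQ j)].
- move=> [i|] [j|] //= _ x xP; apply/negP => /codomP [[k|] /= Ex].
  + have ki : k = i by apply: (Rd k i x); rewrite inE ?Ex ?eqxx -?Ex ?xP ?orbT.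
    by move: (Ru i); rewrite /= -{1}ki -Ex xP.
  + by case/negP: vC; rewrite -Ex; apply: RC xP.
  + by case/negP: (QC _ _ xP); rewrite Ex.
  + by case: (HQ j) => _ _ _; rewrite -Ex xP.
- move=> [i|] [j|] [k|] [l|] //=.
  + move=> /eqP -> /eqP -> x xi xk; suff -> : i = k by [].
    by apply: (Rd i k x); rewrite inE ?xi ?xk orbT.
  + by move=> _ _ x /RC xC /QC; rewrite xC.
  + by move=> _ _ x /QC xC /RC; rewrite (negbTE xC).
  + by move=> _ _ x xj xl; rewrite (Qd j l x).
- move=> [i|] [j|] //=; first by move/eqP ->.
  by move=> _; case: (HQ j).
Qed.

Let spoked_rot v C p Q k : spoked_cycle e v C p Q -> spoked_cycle e v (rot k C) p Q.
Proof.
case=> -[uC cC vC p_inj] HQ QC Qd.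
split=> [|i|i x|//]; rewrite ?rot_uniq ?rot_cycle ?mem_rot //; last exact: QC.
Qed.

Let spoked_reindex v C p Q (s : 'I_3 -> 'I_3) : injective s ->
  spoked_cycle e v C p Q -> spoked_cycle e v C (p \o s) (Q \o s).
Proof.
move=> s_inj [[uC cC vC p_inj] HQ QC Qd]; split.
- by split=> //; apply: inj_comp.
- by move=> i; apply: HQ.
- by move=> i x; apply: QC.
- by move=> i j x xi xj; apply/s_inj; apply: Qd xi xj.
Qed.

(** The cycle is rotated to start at [p i0]. The other two ends follow in one of two orders, and
    exchanging the names of their spokes reduces the second order to the first. *)
Lemma W3_of_spoked v C p Q : spoked_cycle e v C p Q -> contains_subdivision W3 D.
Proof.
move=> H; have [[_ _ _ p_inj] HQ _ _] := H.
have [p0C _ _ _] := HQ i0; have [k s Es] := rot_to p0C.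
have {}H := spoked_rot k H; rewrite {}Es in H; have [[us _ _ _] {}HQ _ _] := H.
have in_s i : i != i0 -> p i \in s.
  by move=> ne; case: (HQ i); rewrite inE (inj_eq p_inj) (negbTE ne).
have order a b s1 s2 s3 : injective (tnth [tuple i0; a; b]) ->
    s = s1 ++ p a :: s2 ++ p b :: s3 -> contains_subdivision W3 D.
  move=> s_inj Es; pose R := tnth [tuple s1; s2; s3].
  apply: (@W3_of_rim v (p \o tnth [tuple i0; a; b]) (Q \o tnth [tuple i0; a; b]) R).
  by have := spoked_reindex s_inj H; rewrite Es.
have split_at (y : D) (t : seq D) : y \in t -> exists t1 t2, t = t1 ++ y :: t2.
  by case/splitPr => t1 t2; exists t1, t2.
have [s1 [s2 Es]] := split_at _ _ (in_s i1 isT).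
have := in_s i2 isT; rewrite Es mem_cat inE (inj_eq p_inj) /= => /orP [].
  case/split_at => s3 [s4 Es1]; apply: (order i2 i1 s3 s4 s2).
    exact/tuple_uniqP.
  by rewrite Es Es1 -catA.
case/split_at => s3 [s4 Es2]; apply: (order i1 i2 s1 s3 s4); last by rewrite Es Es2.
exact/tuple_uniqP.
Qed.

Lemma contains_W3P : contains_subdivision W3 D <-> wheel_test e.
Proof.
split=> [/spoked_of_W3 [v [C [p [Q /test_of_spoked]]]] //|/spoked_of_test].
by case=> v [C [p [Q /W3_of_spoked]]].
Qed.

End SpokedW3.

(** * Compiling first-order formulas *)

(** A total-correctness triple with a bound on the number of steps; nesting it in its own
    postcondition handles sequences. *)
Definition runs W p s c (Q : state -> Prop) :=
  exists t s', [/\ exec W p s t s', t <= c & Q s'].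

Section Runs.

Variable W : nat.
Implicit Types (s : state) (Q : state -> Prop).

Lemma runs_weaken p s c c' Q Q' : runs W p s c Q -> c <= c' ->
  (forall s', Q s' -> Q' s') -> runs W p s c' Q'.
Proof.
move=> [t [s' [E le q]]] lec H; exists t, s'; split=> //; last exact: H.
exact: leq_trans le lec.
Qed.

Lemma runs_seq p q s c1 c2 Q :
  runs W p s c1 (fun s1 => runs W q s1 c2 Q) -> runs W (Seq p q) s (c1 + c2) Q.
Proof.
move=> [t [s' [E le [u [s'' [E' le' q']]]]]]; exists (t + u), s''; split=> //.
  exact: exec_Seq E E'.
exact: leq_add.
Qed.

Lemma runs_skip s c (Q : state -> Prop) : 0 < c -> Q s -> runs W Skip s c Q.
Proof. by move=> c0 q; exists 1, s; split=> //; apply: exec_Skip. Qed.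

Lemma runs_assign r op x y s (Q : state -> Prop) :
  compute op (value s x) (value s y) < W ->
  Q (set_reg s r (compute op (value s x) (value s y))) ->
  runs W (Assign r op x y) s 1 Q.
Proof. by move=> lt q; exists 1; eexists; split; [apply: exec_Assign| |exact: q]. Qed.

Lemma runs_read r a x s (Q : state -> Prop) : arr s a (value s x) < W ->
  Q (set_reg s r (arr s a (value s x))) -> runs W (Read r a x) s 1 Q.
Proof. by move=> lt q; exists 1; eexists; split; [apply: exec_Read| |exact: q]. Qed.

Lemma runs_write a x y s (Q : state -> Prop) : value s y < W ->
  Q (set_arr s a (value s x) (value s y)) -> runs W (Write a x y) s 1 Q.
Proof. by move=> lt q; exists 1; eexists; split; [apply: exec_Write| |exact: q]. Qed.

Lemma runs_if b x y p q s c Q :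
  runs W (if test b (value s x) (value s y) then p else q) s c Q ->
  runs W (If b x y p q) s c.+1 Q.
Proof. by case=> t [s' [E le q']]; exists t.+1, s'; split=> //; apply: exec_If. Qed.

(** Each round costs the test and the increment on top of the body, and one more unit pays for the
    last test. The invariant is asked of the state after the increment. *)
Lemma runs_upto i b body m c (Inv : nat -> state -> Prop) k s :
  m < W -> i != b -> k <= m -> reg s i = k -> reg s b = m -> Inv k s ->
  (forall k s, k < m -> reg s i = k -> reg s b = m -> Inv k s ->
     runs W body s c (fun s' =>
       [/\ reg s' i = k, reg s' b = m & Inv k.+1 (set_reg s' i k.+1)])) ->
  runs W (While Lt (Reg i) (Reg b) (Seq body (Assign i Add (Reg i) (Const 1)))) s
    ((m - k) * (c + 2) + 1) (fun s' => [/\ reg s' i = m, reg s' b = m & Inv m s']).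
Proof.
move=> mW ib km ri rb inv step; move Ed: (m - k) => d.
elim: d k s km ri rb inv Ed => [|d IH] k s km ri rb inv Ed.
  have Ek : k = m by lia.
  exists 1, s; split; first by apply: exec_WhileF; rewrite /= ri rb Ek ltnn.
    by rewrite addn1.
  by split; rewrite // -?Ek.
have ltk : k < m by lia.
have [t [s' [E le [ri' rb' inv']]]] := step _ _ ltk ri rb inv.
have [|||u [s'' [E' le' q]]] := IH k.+1 (set_reg s' i k.+1) ltk _ _ inv'.
- by rewrite /= eqxx.
- by rewrite /= eq_sym (negbTE ib).
- by lia.
exists ((t + 1) + u).+1, s''; split=> //; last by lia.
apply: (exec_WhileT _ _ E'); first by rewrite /= ri rb.
apply: (exec_Seq E); have -> : k.+1 = compute Add (value s' (Reg i)) (value s' (Const 1)).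
  by rewrite /= ri' addn1.
by apply: exec_Assign; rewrite /= ri'; lia.
Qed.

Definition for_loop i body :=
  Seq (Assign i Add (Const 0) (Const 0))
      (While Lt (Reg i) (Reg 0) (Seq body (Assign i Add (Reg i) (Const 1)))).

Lemma runs_for i body n c (Inv : nat -> state -> Prop) s :
  n < W -> i != 0 -> reg s 0 = n -> Inv 0 (set_reg s i 0) ->
  (forall k s, k < n -> reg s i = k -> reg s 0 = n -> Inv k s ->
     runs W body s c (fun s' =>
       [/\ reg s' i = k, reg s' 0 = n & Inv k.+1 (set_reg s' i k.+1)])) ->
  runs W (for_loop i body) s (n * (c + 2) + 2)
    (fun s' => reg s' 0 = n /\ Inv n s').
Proof.
move=> nW i0 r0 inv step.
have -> : n * (c + 2) + 2 = 1 + (n * (c + 2) + 1) by lia.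
apply: runs_seq; apply: runs_assign; first by rewrite /=; lia.
have [||t [s' [E le [_ r0' inv']]]] :=
  @runs_upto i 0 body n c Inv 0 (set_reg s i 0) nW i0 (leq0n n) _ _ inv step.
- by rewrite /= eqxx.
- by rewrite /= eq_sym (negbTE i0).
by exists t, s'; split; rewrite // -(subn0 n).
Qed.

End Runs.

(** Horner's rule in base [n], most significant digit first. *)
Definition address (n : nat) (xs : seq nat) : nat :=
  foldl (fun acc x => acc * n + x) 0 xs.

Lemma address_rcons n xs x : address n (rcons xs x) = address n xs * n + x.
Proof. by rewrite /address foldl_rcons. Qed.

Lemma address_lt n xs : all (gtn n) xs -> address n xs < n ^ size xs.
Proof.
elim/last_ind: xs => // xs x IH; rewrite all_rcons size_rcons address_rcons.
case/andP => /= xn /IH; rewrite expnS; nia.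
Qed.

Lemma address_inj n xs ys : all (gtn n) xs -> all (gtn n) ys ->
  size xs = size ys -> address n xs = address n ys -> xs = ys.
Proof.
elim/last_ind: xs ys => [|xs x IH] ys; first by case: ys.
case/lastP: ys => [|ys y]; first by rewrite size_rcons.
rewrite !all_rcons !size_rcons !address_rcons => /andP [/= xn axs] /andP [/= yn ays] [Es] E.
have n0 : 0 < n by lia.
have Ex : x = y by have := congr1 (modn^~ n) E; rewrite !modnMDl !modn_small.
have Ea : address n xs = address n ys.
  by have := congr1 (divn^~ n) E; rewrite !divnMDl // !divn_small // !addn0.
by rewrite (IH ys) // Ex.
Qed.

(** Variables are de Bruijn levels: a quantifier appends to the environment, so outer variables keep
    their numbers and hence their registers. *)
Inductive formula :=
| FEq of nat & nat
| FTab of nat & seq nat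
| FNot of formula
| FAnd of formula & formula
| FEx of formula.

Definition FOr f g := FNot (FAnd (FNot f) (FNot g)).

Fixpoint eval n (tab : nat -> nat -> nat) (env : seq nat) f : bool :=
  match f with
  | FEq i j => nth 0 env i == nth 0 env j
  | FTab a xs => tab a (address n [seq nth 0 env x | x <- xs]) != 0
  | FNot f => ~~ eval n tab env f
  | FAnd f g => eval n tab env f && eval n tab env g
  | FEx f => has (fun x => eval n tab (rcons env x) f) (iota 0 n)
  end.

(** Arrays 0 and 1 hold the input and are excluded as tables; arity at most 4 keeps addresses within
    the word bound. *)
Fixpoint wf lvl f :=
  match f with
  | FEq i j => (i < lvl) && (j < lvl)
  | FTab a xs => [&& 1 < a, all (gtn lvl) xs & size xs <= 4]
  | FNot f => wf lvl f
  | FAnd f g => wf lvl f && wf lvl g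
  | FEx f => wf lvl.+1 f
  end.

Fixpoint tables f : seq nat :=
  match f with
  | FEq _ _ => [::]
  | FTab a _ => [:: a]
  | FNot f | FEx f => tables f
  | FAnd f g => tables f ++ tables g
  end.

Lemma eval_ext n tab tab' f env :
  (forall a, a \in tables f -> forall j, tab a j = tab' a j) ->
  eval n tab env f = eval n tab' env f.
Proof.
elim: f env => //= [a xs|f IHf|f IHf g IHg|f IHf] env H.
- by rewrite H ?mem_head.
- by rewrite IHf.
- by rewrite IHf ?IHg // => a ain j; apply: H; rewrite mem_cat ain ?orbT.
- by apply: eq_has => x; apply: IHf.
Qed.

(* Register 0 holds n, register 1 the result, register 2 an address, register 3
   a loop counter, and register [4 + i] the variable number [i]. *)
Definition var i := 4 + i.

Definition compile_address d xs : program :=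
  foldl (fun p x => Seq p (Seq (Assign d Mul (Reg d) (Reg 0))
                               (Assign d Add (Reg d) (Reg (var x)))))
        (Assign d Add (Const 0) (Const 0)) xs.

(** The body of a quantifier runs only while register 1 is 0, so overwriting this register computes
    the disjunction. A conjunction likewise skips its second part when the first is false. *)
Fixpoint compile lvl f : program :=
  match f with
  | FEq i j => If Eq (Reg (var i)) (Reg (var j))
                 (Assign 1 Add (Const 1) (Const 0)) (Assign 1 Add (Const 0) (Const 0))
  | FTab a xs => Seq (compile_address 1 xs) (Read 1 a (Reg 1))
  | FNot f => Seq (compile lvl f) (Assign 1 Sub (Const 1) (Reg 1))
  | FAnd f g => Seq (compile lvl f) (If Ne (Reg 1) (Const 0) (compile lvl g) Skip)
  | FEx f => Seq (Assign 1 Add (Const 0) (Const 0))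
      (for_loop (var lvl) (If Eq (Reg 1) (Const 0) (compile lvl.+1 f) Skip))
  end.

Fixpoint cost n f :=
  match f with
  | FEq _ _ => 2
  | FTab _ xs => 2 * size xs + 2
  | FNot f => cost n f + 1
  | FAnd f g => cost n f + (cost n g + 2)
  | FEx f => n * (cost n f + 4) + 3
  end.

Lemma has_iotaS (a : pred nat) k : has a (iota 0 k.+1) = has a (iota 0 k) || a k.
Proof. by rewrite -addn1 iotaD has_cat /= orbF. Qed.

Section Compile.

Variable n : nat.

Definition holds_env (s : state) (env : seq nat) :=
  [/\ reg s 0 = n, all (gtn n) env &
      forall i, i < size env -> reg s (var i) = nth 0 env i].

Definition bool_tables (s : state) := forall a j, 1 < a -> arr s a j <= 1.

(** Registers 1 and 2 and the variables from number [lvl] on are scratch; [n] and the counter in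
    register 3 survive. *)
Definition agree_upto lvl (s s' : state) :=
  forall r, r < 4 + lvl -> r != 1 -> r != 2 -> reg s' r = reg s r.

Lemma holds_env_agree lvl s s' env : holds_env s env -> size env <= lvl ->
  agree_upto lvl s s' -> holds_env s' env.
Proof.
move=> [r0 an rv] le ag; split=> //; first by rewrite ag.
by move=> i lti; rewrite ag ?rv // /var; lia.
Qed.

Lemma nth_all_lt env x : all (gtn n) env -> x < size env -> nth 0 env x < n.
Proof. by move=> /allP an lt; apply: an; apply: mem_nth. Qed.

Variable W : nat.
Hypothesis nW : n ^ 4 + n + 2 <= W.

Let n_lt_W : n < W. Proof. lia. Qed.

Lemma compile_address_correct d s env xs : 0 < d <= 2 -> holds_env s env ->
  all (gtn (size env)) xs -> size xs <= 4 ->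
  runs W (compile_address d xs) s (2 * size xs + 1) (fun s' =>
    [/\ arr s' = arr s, reg s' d = address n [seq nth 0 env x | x <- xs] &
        forall r, r != d -> reg s' r = reg s r]).
Proof.
move=> hd henv; have [r0 an rv] := henv.
elim/last_ind: xs => [|xs x IH] /=.
  move=> _ _; apply: runs_assign => //=; first by lia.
  by split=> //= [|r /negbTE ->]; rewrite ?eqxx.
rewrite all_rcons size_rcons => /andP [/= xl axs] sz.
rewrite /compile_address foldl_rcons -/(compile_address d xs).
apply: (@runs_weaken _ _ _ ((2 * size xs + 1) + (1 + 1)) _ _ _ _ _ (fun s' P => P)); last by lia.
have szxs : size xs <= 4 by lia.
apply: runs_seq; apply: (runs_weaken (IH axs szxs)) => // s1 [ea ed er].
have d0 : (0 == d) = false by lia.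
have lta : address n [seq nth 0 env y | y <- xs] < n ^ size xs.
  rewrite -(size_map (nth 0 env)); apply: address_lt; rewrite all_map.
  by apply/allP => y /(allP axs) /= yl; apply: nth_all_lt.
have ltx := nth_all_lt an xl.
(* At most four digits are read, so no intermediate value of Horner's rule overflows. *)
have le4 : n ^ (size xs).+1 <= n ^ 4 by apply: leq_pexp2l; lia.
rewrite expnS in le4.
have vx : reg s1 (var x) = nth 0 env x by rewrite er ?rv // /var; lia.
have vd : (var x == d) = false by rewrite /var; lia.
have r10 : reg s1 0 = n by rewrite er ?d0.
apply: runs_seq; apply: runs_assign => /=; first by rewrite ed r10; nia.
apply: runs_assign => /=; rewrite eqxx vd ed r10 vx; first by nia.
split=> //=; first by rewrite map_rcons address_rcons.
by move=> r rd; rewrite (negbTE rd) er.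
Qed.

Lemma compile_correct f lvl s env : wf lvl f -> size env = lvl ->
  holds_env s env -> bool_tables s ->
  runs W (compile lvl f) s (cost n f) (fun s' =>
    [/\ arr s' = arr s, reg s' 1 = eval n (arr s) env f & agree_upto lvl s s']).
Proof.
elim: f lvl s env => [i j|a xs|f IHf|f IHf g IHg|f IHf] lvl s env /=.
- case/andP => il jl sz [r0 an rv] _; apply: runs_if => /=.
  rewrite !rv ?sz //.
  case: eqP => _; apply: runs_assign; rewrite /= ?addn0; try lia.
    by split=> // r _ /negbTE /= ->.
  by split=> // r _ /negbTE /= ->.
- case/and3P => a1 axs sxs sz henv bt; rewrite -sz in axs.
  have -> : 2 * size xs + 2 = (2 * size xs + 1) + 1 by lia.
  apply: runs_seq.
  apply: (runs_weaken (compile_address_correct _ henv axs sxs)) => // s1 [ea ed er].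
  have le1 := bt a (address n [seq nth 0 env x | x <- xs]) a1.
  apply: runs_read => /=; rewrite ea ed; first by lia.
  split=> //=; last by move=> r _ r1 _ /=; rewrite (negbTE r1) er.
  by move: le1; case: (arr s a _) => [|[]].
- move=> wff sz henv bt; apply: runs_seq.
  apply: (runs_weaken (IHf _ _ _ wff sz henv bt)) => // s1 [ea e1 ag].
  apply: runs_assign => /=; first by lia.
  split=> //=; first by rewrite e1; case: eval.
  by move=> r rl r1 r2; rewrite /= (negbTE r1) ag.
- case/andP => wff wfg sz henv bt; apply: runs_seq.
  apply: (runs_weaken (IHf _ _ _ wff sz henv bt)) => // s1 [ea e1 ag].
  rewrite addn2; apply: runs_if; rewrite /= e1; case: (eval n (arr s) env f) e1 => /= e1; last first.
    by apply: runs_skip => //; split.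
  have henv1 : holds_env s1 env by apply: holds_env_agree henv _ ag; rewrite sz.
  have bt1 : bool_tables s1 by move=> a j; rewrite ea; apply: bt.
  apply: (runs_weaken (IHg _ _ _ wfg sz henv1 bt1)) => // s2 [ea2 e2 ag2].
  by rewrite ea2 e2 ea; split=> // r rl r1 r2; rewrite ag2 ?ag.
- move=> wff sz henv bt; have [r0 an rv] := henv.
  have -> : n * (cost n f + 4) + 3 = 1 + (n * ((cost n f + 2) + 2) + 2) by lia.
  apply: runs_seq; apply: runs_assign => /=; first by lia.
  set s1 := set_reg s 1 0.
  pose Inv k s' := [/\ arr s' = arr s,
    reg s' 1 = has (fun x => eval n (arr s) (rcons env x) f) (iota 0 k) &
    agree_upto lvl s s'].
  apply: (@runs_weaken _ _ _ _ _ _ _ (@runs_for _ (var lvl) _ n (cost n f + 2) Inv s1 _ _ _ _ _)) => //.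
  + rewrite /Inv; split=> //= r rl r1 r2 /=.
    by rewrite (negbTE r1) (_ : (r == var lvl) = false) // /var; lia.
  + move=> k s2 kn rk r20 [ea e1 ag]; rewrite addn2; apply: runs_if.
    have next b s3 : arr s3 = arr s -> reg s3 1 = nat_of_bool b ->
        agree_upto lvl.+1 s2 s3 ->
        has (fun x => eval n (arr s) (rcons env x) f) (iota 0 k.+1) = b ->
        [/\ reg s3 (var lvl) = k, reg s3 0 = n & Inv k.+1 (set_reg s3 (var lvl) k.+1)].
      move=> ea3 e3 ag3 Eb; split; [by rewrite ag3 // /var; lia|by rewrite ag3|].
      split=> //=; first by rewrite e3 -Eb.
      move=> r rl r1 r2 /=.
      by rewrite (_ : (r == var lvl) = false) ?ag3 ?ag // /var; lia.
    rewrite has_iotaS /= e1 in next *.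
    case: (has _ _) e1 next => /= e1 next.
      by apply: runs_skip; [lia | apply: (next true)].
    have henv2 : holds_env s2 (rcons env k).
      split=> //; first by rewrite all_rcons /= kn.
      move=> i; rewrite size_rcons sz ltnS nth_rcons sz leq_eqVlt => /orP [/eqP ->|il].
        by rewrite ltnn eqxx.
      by rewrite il ag ?rv ?sz // /var; lia.
    have bt2 : bool_tables s2 by move=> a j; rewrite ea; apply: bt.
    have szr : size (rcons env k) = lvl.+1 by rewrite size_rcons sz.
    apply: (runs_weaken (IHf _ _ _ wff szr henv2 bt2)); first by lia.
    by move=> s3 [ea3 e3 ag3]; rewrite ea in ea3 e3; apply: next ea3 e3 ag3 _.
  + by move=> s' [_ [? ? ?]]; split.
Qed.

End Compile.

(** * Filling tables and loading the input *)

(* The first [lvl] variables keep their current values, [k] more are looped over. *)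
Fixpoint fill k lvl a f : program :=
  match k with
  | 0 => Seq (compile lvl f) (Seq (compile_address 2 (iota 0 lvl)) (Write a (Reg 2) (Reg 1)))
  | k.+1 => for_loop (var lvl) (fill k lvl.+1 a f)
  end.

Fixpoint fill_cost n k lvl f :=
  match k with
  | 0 => cost n f + ((2 * lvl + 1) + 1)
  | k.+1 => n * (fill_cost n k lvl.+1 f + 2) + 2
  end.

Section Fill.

Variables W n : nat.
Hypothesis nW : n ^ 4 + n + 2 <= W.

(** [P] selects the tuples whose entries are already rewritten, with [f] evaluated in the old state;
    the other entries are still the old ones. *)
Definition filled (s : state) lvl k a f (P : pred (seq nat)) (s' : state) :=
  [/\ agree_upto lvl s s', bool_tables s',
      forall b, b != a -> forall j, arr s' b j = arr s b j &
      forall xs, size xs = lvl + k -> all (gtn n) xs ->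
        arr s' a (address n xs) =
          if P xs then nat_of_bool (eval n (arr s) xs f) else arr s a (address n xs)].

Lemma map_nth_iota (env : seq nat) : [seq nth 0 env x | x <- iota 0 (size env)] = env.
Proof. by rewrite -/(mkseq _ _) mkseq_nth. Qed.

Lemma take_eq_rcons (env xs : seq nat) x : size env < size xs ->
  (take (size env).+1 xs == rcons env x) =
  (take (size env) xs == env) && (nth 0 xs (size env) == x).
Proof. by move=> lt; rewrite (take_nth 0 lt) eqseq_rcons. Qed.

(** Since [a] does not occur in [f], writing to this array never changes the value of [f], and by
    injectivity of [address] each write affects one tuple only. *)
Lemma fill_correct k lvl a f s env : wf (lvl + k) f -> 1 < a -> a \notin tables f ->
  lvl + k <= 4 -> size env = lvl -> holds_env n s env -> bool_tables s ->
  runs W (fill k lvl a f) s (fill_cost n k lvl f)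
    (filled s lvl k a f (fun xs => take lvl xs == env)).
Proof.
move=> + a1 af; elim: k lvl s env => [|k IH] lvl s env wff le4 sz henv bt /=.
  rewrite addn0 in wff le4; apply: runs_seq.
  apply: (runs_weaken (compile_correct nW wff sz henv bt)) => // s1 [ea e1 ag].
  have henv1 : holds_env n s1 env by apply: holds_env_agree henv _ ag; rewrite sz.
  apply: runs_seq.
  have al : all (gtn (size env)) (iota 0 lvl).
    by apply/allP => x; rewrite mem_iota sz.
  have sz4 : size (iota 0 lvl) <= 4 by rewrite size_iota.
  have := compile_address_correct nW (d := 2) isT henv1 al sz4; rewrite size_iota => R.
  apply: (runs_weaken R) => // s2 [ea2 e2 ag2].
  have r1 : reg s2 1 = eval n (arr s) env f by rewrite ag2.
  rewrite -sz map_nth_iota in e2.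
  apply: runs_write; rewrite /= r1; first by case: eval; lia.
  split=> /=.
  + by move=> r rl rn1 rn2; rewrite /= ag2 // ag.
  + move=> b j b1; rewrite /= ea2 ea; case: ifP => _; first by case: eval.
    exact: bt.
  + by move=> b /negbTE ba j; rewrite ba ea2 ea.
  + move=> xs; rewrite addn0 => szx ax; rewrite eqxx e2 ea2 ea /= take_oversize ?szx //.
    case: (eqVneq xs env) => [->|ne]; first by rewrite eqxx.
    case: eqP => // /address_inj E; case/eqP: ne; apply: E => //; last by rewrite szx.
    by case: henv.
have [r0 an rv] := henv.
(* Before round [x], the tuples extending [env] by a coordinate below [x] are done. *)
pose Inv x := filled s lvl k.+1 a f
  (fun xs => (take lvl xs == env) && (nth 0 xs lvl < x)).
apply: (runs_weaken (@runs_for _ (var lvl) _ n (fill_cost n k lvl.+1 f) Inv s _ _ _ _ _)) => //.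
- by lia.
- split=> //= [r rl r1 r2|xs _ _]; last by rewrite ltn0 andbF.
  by rewrite /= (_ : (r == var lvl) = false) // /var; lia.
- move=> x s1 xn rx r10 [ag bt1 off ent].
  have henv1 : holds_env n s1 (rcons env x).
    split=> //; first by rewrite all_rcons /= xn.
    move=> i; rewrite size_rcons sz ltnS nth_rcons sz leq_eqVlt => /orP [/eqP ->|il].
      by rewrite ltnn eqxx.
    by rewrite il ag ?rv ?sz // /var; lia.
  have wff1 : wf (lvl.+1 + k) f by rewrite addSnnS.
  have le41 : lvl.+1 + k <= 4 by rewrite addSnnS.
  have szr : size (rcons env x) = lvl.+1 by rewrite size_rcons sz.
  apply: (runs_weaken (IH _ _ _ wff1 le41 szr henv1 bt1)) => // s2 [ag2 bt2 off2 ent2].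
  split; [by rewrite ag2 // /var; lia|by rewrite ag2|].
  split=> //=.
  + move=> r rl r1 r2 /=; rewrite (_ : (r == var lvl) = false); last by rewrite /var; lia.
    by rewrite ag2 ?ag //; lia.
  + by move=> b ba j; rewrite off2 ?off.
  + move=> xs szx ax; rewrite ent2 ?addSnnS // ent //.
    have evE : eval n (arr s1) xs f = eval n (arr s) xs f.
      by apply: eval_ext => b bf j; rewrite off //; apply: contraNneq af => <-.
    have lt : size env < size xs by rewrite szx sz; lia.
    rewrite -sz take_eq_rcons // evE.
    case: (take _ _ == env) => //=; rewrite ltnS [nth 0 xs _ <= x]leq_eqVlt.
    by case: eqVneq.
- move=> s' [_ [ag bt' off ent]]; split=> // xs szx ax; rewrite ent //.
  suff -> : nth 0 xs lvl < n by rewrite andbT.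
  by apply: nth_all_lt => //; rewrite szx; lia.
Qed.

End Fill.

(** * Loading the input into an adjacency matrix *)

Section Load.

Variables (n : nat) (e : rel 'I_n) (adj : 'I_n -> seq 'I_n).
Hypothesis adjP : adjacency_lists e adj.

Let rows := [seq [seq val v | v <- adj u] | u <- enum 'I_n].

Definition row_start u := size (flatten (take u rows)).

Lemma nth_offsets u : u <= n -> nth 0 (offsets adj) u = row_start u.
Proof.
move=> le; have szr : size [seq size (adj u) | u <- enum 'I_n] = n.
  by rewrite size_map size_enum_ord.
rewrite /offsets /row_start; case: u le => [|u] ltu; first by rewrite take0.
have Es : [seq size r | r <- rows] = [seq size (adj u) | u <- enum 'I_n].
  by rewrite -map_comp; apply: eq_map => v; exact: size_map.
rewrite /= nth_scanl ?szr // size_flatten /shape map_take Es.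
set t := take _ _; elim/last_ind: t => // t x IH.
by rewrite foldl_rcons IH -cats1 sumn_cat /= addn0.
Qed.

Lemma nth_rows (u : 'I_n) : nth [::] rows u = [seq val v | v <- adj u].
Proof. by rewrite (nth_map u) ?size_enum_ord // nth_ord_enum. Qed.

Lemma row_startS (u : 'I_n) : row_start u.+1 = row_start u + size (adj u).
Proof.
have ltu : u < size rows by rewrite size_map size_enum_ord.
rewrite /row_start (take_nth [::] ltu) flatten_rcons size_cat.
by rewrite nth_rows size_map.
Qed.

Lemma nth_heads (u : 'I_n) i : i < size (adj u) ->
  nth 0 (heads adj) (row_start u + i) = nth 0 [seq val v | v <- adj u] i.
Proof.
move=> lti; rewrite /heads -/rows -{1}(cat_take_drop u rows) flatten_cat nth_cat.
rewrite -/(row_start u) ltnNge leq_addr /= addKn.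
have ltu : u < size rows by rewrite size_map size_enum_ord.
rewrite (drop_nth [::] ltu) nth_rows /= nth_cat.
by rewrite size_map lti.
Qed.

Lemma size_adj (u : 'I_n) : size (adj u) <= n.
Proof.
have [uq _] := adjP u; rewrite -(card_uniqP uq).
by have := max_card (mem (adj u)); rewrite card_ord.
Qed.

(** Used to show that positions in array 1 fit into a word. *)
Lemma row_start_le u : u <= n -> row_start u <= u * n.
Proof.
elim: u => [|u IH] ltu; first by rewrite /row_start take0.
have := row_startS (Ordinal ltu); have := size_adj (Ordinal ltu); have := IH (ltnW ltu).
move=> /= ? ? ->; nia.
Qed.

(** Register 4 is the tail [u], register 5 the position in array 1, which is carried over from row
    to row, and register 6 the end of the current row. *)
Definition load_row : program :=
  Seq (Assign 1 Add (Reg 4) (Const 1)) (Seq (Read 6 0 (Reg 1))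
    (While Lt (Reg 5) (Reg 6) (Seq
      (Seq (Read 1 1 (Reg 5)) (Seq (Assign 2 Mul (Reg 4) (Reg 0))
        (Seq (Assign 2 Add (Reg 2) (Reg 1)) (Write 2 (Reg 2) (Const 1)))))
      (Assign 5 Add (Reg 5) (Const 1))))).

Definition load : program := for_loop 4 load_row.

Variable W : nat.
Hypothesis nW : n ^ 4 + n + 2 <= W.

Definition loaded (P : 'I_n -> pred 'I_n) (s : state) :=
  [/\ forall j, arr s 0 j = nth 0 (offsets adj) j,
      forall j, arr s 1 j = nth 0 (heads adj) j,
      bool_tables s &
      forall u v : 'I_n, arr s 2 (address n [:: val u; val v]) = P u v].

Lemma load_row_correct (u : 'I_n) s :
  reg s 4 = u -> reg s 0 = n -> reg s 5 = row_start u ->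
  loaded (fun x y => (x < u) && e x y) s ->
  runs W load_row s (n * 6 + 3) (fun s' =>
    [/\ reg s' 4 = u, reg s' 0 = n, reg s' 5 = row_start u.+1 &
        loaded (fun x y => (x < u.+1) && e x y) s']).
Proof.
have n2 : n * n <= n ^ 4 by rewrite -[n * n]/(n ^ 2); apply: leq_pexp2l; have := ltn_ord u; lia.
have rS := row_startS u; have rle := row_start_le (ltn_ord u).
have uW : u.+1 * n <= n * n by rewrite leq_mul2r ltn_ord orbT.
move=> r4 r0 r5 [A0 A1 bt E].
have -> : n * 6 + 3 = 1 + (1 + (n * (4 + 2) + 1)) by lia.
apply: runs_seq; apply: runs_assign; rewrite /= r4; first by have := ltn_ord u; lia.
apply: runs_seq; apply: runs_read; rewrite /= A0 addn1 nth_offsets //; first by lia.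
set s1 := set_reg _ 6 _.
(* Done are the rows before [u] and the part of row [u] before position [k]. *)
pose Inv k s' := [/\ row_start u <= k, reg s' 4 = u, reg s' 0 = n &
  loaded (fun x y => (x < u) && e x y || (x == u) && (y \in take (k - row_start u) (adj u))) s'].
have le1 : row_start u <= row_start u.+1 by lia.
have deg := size_adj u.
apply: (@runs_weaken _ _ _ ((row_start u.+1 - row_start u) * (4 + 2) + 1)
   _ _ _ (@runs_upto _ 5 6 _ (row_start u.+1) 4 Inv (row_start u) s1 _ _ _ _ _ _ _)) => //.
- by lia.
- split=> //; split=> // x y; rewrite /= subnn take0 E /=; by rewrite andbF orbF.
- move=> k s2 ltk r25 r26 [lek r24 r20 [A0' A1' bt' E']].
  pose i := k - row_start u; pose v := nth u (adj u) i.
  have lti : i < size (adj u) by rewrite /i; lia.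
  have Ev : nth 0 (heads adj) k = v.
    by rewrite -(subnKC lek) nth_heads // (nth_map u).
  have vn := ltn_ord v.
  have EA : u * n + v = address n [:: val u; val v] by rewrite /address /= mul0n.
  apply: (@runs_seq _ _ _ _ 1 3); apply: runs_read; rewrite /= r25 A1' Ev; first by lia.
  apply: (@runs_seq _ _ _ _ 1 2); apply: runs_assign; rewrite /= r24 r20; first by nia.
  apply: (@runs_seq _ _ _ _ 1 1); apply: runs_assign; rewrite /=; first by nia.
  apply: runs_write => /=; first by lia.
  split=> //; split=> //=; first by lia.
  split=> //=.
  + by move=> b j b1 /=; case: ifP => // _; apply: bt'.
  + move=> x y; rewrite EA.
    rewrite subSn // -/i (take_nth u lti) -/v mem_rcons inE E' -/i.
    case: eqP => [/address_inj E2|ne].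
      have : [:: val x; val y] = [:: val u; val v] by apply: E2; rewrite //= !ltn_ord.
      case=> /val_inj -> /val_inj ->.
      by rewrite !eqxx orbT.
    case: (eqVneq x u) ne => [->|//]; case: (eqVneq y v) => [-> []//|//].
- by lia.
move=> s' [r5' _ [_ r4' r0' [? ? ? E']]]; split=> //; split=> // x y; rewrite E'.
rewrite rS addKn take_size ltnS [x <= u]leq_eqVlt; have [_ ->] := adjP u.
case: (eqVneq x u) => [->|ne] /=; first by rewrite ltnn eqxx.
by rewrite (_ : (val x == val u) = false) ?orbF //; apply/negbTE.
Qed.

Lemma load_correct : runs W load (input_state adj) (n * (n * 6 + 3 + 2) + 2)
  (fun s => reg s 0 = n /\ loaded e s).
Proof.
pose Inv k s := reg s 5 = row_start k /\ loaded (fun x y => (x < k) && e x y) s.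
apply: (runs_weaken (@runs_for _ 4 _ n (n * 6 + 3) Inv (input_state adj) _ _ _ _ _)) => //.
- by lia.
- split; first by rewrite /row_start take0.
  by split=> // b j; case: b => [|[]].
- move=> k s kn r4 r0 [r5 ld].
  apply: (runs_weaken (load_row_correct (u := Ordinal kn) r4 r0 r5 ld)) => //.
  by move=> s' [? ? ? ?]; split.
move=> s [r0 [_ [? ? ? E]]]; split=> //; split=> // x y.
by rewrite E ltn_ord.
Qed.

End Load.

(** * The algorithm *)

Section BoundedReach.

Variables (V : finType) (e : rel V).

(** Walks with at least one and at most [k.+1] arcs. *)
Fixpoint reach_le k s a b u : bool :=
  match k with
  | 0 => avoid e a b s u
  | k.+1 => reach_le k s a b u || [exists w, reach_le k s a b w && avoid e a b w u]
  end.

Lemma reach_le_reach k s a b u : reach_le k s a b u -> reach e s a b u.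
Proof.
elim: k u => [|k IH] u /=; first exact: reach_arc.
by case/orP => [/IH //|/existsP [w /andP [/IH rw wu]]]; apply: reach_step rw wu.
Qed.

Lemma path_reach_le k s a b p : path (avoid e a b) s p -> p != [::] ->
  size p <= k.+1 -> reach_le k s a b (last s p).
Proof.
elim: k p => [|k IH] p; first by case: p => [|x [|]] //=; rewrite andbT.
case/lastP: p => // p x; rewrite rcons_path last_rcons size_rcons ltnS /=.
case/andP => pp lx _ sz; case: p pp lx sz => [|y p] pp lx sz.
  have := IH [:: x]; rewrite /= lx andbT => -> //; exact: lx.
apply/orP; right; apply/existsP; exists (last s (y :: p)).
by rewrite (IH (y :: p)).
Qed.

(** The walk is shortened after its first arc only, since it may return to [s]; the vertices after
    the start are then distinct, so at most [#|V|] in number. *)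
Lemma reach_leE k s a b u : #|V| <= k -> reach_le k s a b u = reach e s a b u.
Proof.
move=> le; apply/idP/idP; first exact: reach_le_reach.
case/reachP => -[|x p] [] //= /andP [sx pp] _ <-.
case/shortenP: pp => p' pp' up' _.
apply: (@path_reach_le k s a b (x :: p')); rewrite //= ?sx //.
have szV : size (x :: p') <= #|V| by rewrite -(card_uniqP up') max_card.
exact: leq_trans (ltnW szV) le.
Qed.

End BoundedReach.

(* Array 2 is the adjacency matrix; arrays 3 and 4 hold in turn the tables of
   [reach_le k].  In [f_avoid], [f_init] and [f_step] the variables are
   [s, a, b, u] followed by the next to last vertex of a path; in [f_wheel] they
   are [v, w, x, z] followed by the inner bound variables. *)
Definition f_arc i j := FTab 2 [:: i; j].
Definition f_reach t s a b u := FTab t [:: s; a; b; u].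
Definition f_avoid i := FAnd (f_arc i 3) (FAnd (FNot (FEq 3 1)) (FNot (FEq 3 2))).
Definition f_init := f_avoid 0.
Definition f_step t :=
  FOr (f_reach t 0 1 2 3) (FEx (FAnd (f_reach t 0 1 2 4) (f_avoid 4))).

Definition f_jump i j :=
  FEx (FAnd (f_arc 4 j) (FAnd (f_reach 3 0 0 0 4) (FNot (f_reach 3 0 i i 4)))).
Definition f_linked :=
  FNot (FEx (FEx (FNot (FOr (f_reach 3 0 4 5 1)
                            (FOr (f_reach 3 0 4 5 2) (f_reach 3 0 4 5 3)))))).
Definition f_wheel :=
  FEx (FEx (FEx (FEx (FAnd (f_jump 1 2) (FAnd (f_jump 2 3)
    (FAnd (f_reach 3 3 0 2 1) (FAnd (FNot (FEq 3 0)) f_linked))))))).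

(** A table is not read while it is being filled, so two arrays alternate. One round makes two
    steps, so that [n] rounds leave [reach_le (2 * n)] in array 3. *)
Definition W3_program : program :=
  Seq load (Seq (fill 4 0 3 f_init)
    (Seq (for_loop 3 (Seq (fill 4 0 4 (f_step 3)) (fill 4 0 3 (f_step 4))))
      (Seq (compile 0 f_wheel) (Assign 0 Add (Reg 1) (Const 0))))).

Section Correct.

Variables (n : nat) (e : rel 'I_n).

Lemma has_iota_ord (P : pred nat) : has P (iota 0 n) = [exists x : 'I_n, P x].
Proof.
apply/hasP/existsP => [[x]|[x Px]]; last by exists (val x); rewrite ?mem_iota /=.
by rewrite mem_iota /= => xn Px; exists (Ordinal xn).
Qed.

Definition has_matrix (s : state) := forall u v : 'I_n,
  arr s 2 (address n [:: val u; val v]) = e u v.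

Definition has_table t (R : 'I_n -> 'I_n -> 'I_n -> 'I_n -> bool) (s : state) :=
  forall x a b u : 'I_n, arr s t (address n [:: val x; val a; val b; val u]) = R x a b u.

Lemma eval_arc s env i j (u v : 'I_n) : has_matrix s ->
  nth 0 env i = u -> nth 0 env j = v -> eval n (arr s) env (f_arc i j) = e u v.
Proof. by move=> E /= -> ->; rewrite E; case: (e u v). Qed.

Lemma eval_reach s t R env i j k l (x a b u : 'I_n) : has_table t R s ->
  nth 0 env i = x -> nth 0 env j = a -> nth 0 env k = b -> nth 0 env l = u ->
  eval n (arr s) env (f_reach t i j k l) = R x a b u.
Proof. by move=> T /= -> -> -> ->; rewrite T; case: (R x a b u). Qed.

Lemma eval_avoid s env i (x a b u : 'I_n) : has_matrix s ->
  nth 0 env i = x -> nth 0 env 1 = a -> nth 0 env 2 = b -> nth 0 env 3 = u ->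
  eval n (arr s) env (f_avoid i) = avoid e a b x u.
Proof.
move=> E Ei E1 E2 E3; rewrite /f_avoid /= -/(eval n (arr s) env (f_arc i 3)).
by rewrite -[X in X && _]/(eval n (arr s) env (f_arc i 3)) (eval_arc E Ei E3) E1 E2 E3.
Qed.

Lemma eval_step s t k (x a b u : 'I_n) : has_matrix s ->
  has_table t (reach_le e k) s ->
  eval n (arr s) [:: val x; val a; val b; val u] (f_step t) = reach_le e k.+1 x a b u.
Proof.
move=> E T; set env := [:: _; _; _; _].
rewrite -[LHS]/(~~ (~~ eval n (arr s) env (f_reach t 0 1 2 3) && ~~ has (fun w =>
  eval n (arr s) (rcons env w) (f_reach t 0 1 2 4) &&
  eval n (arr s) (rcons env w) (f_avoid 4)) (iota 0 n))).
rewrite negb_and !negbK (eval_reach T (x := x) (a := a) (b := b) (u := u)) //.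
rewrite has_iota_ord; congr (_ || _); apply: eq_existsb => w.
rewrite (eval_reach T (x := x) (a := a) (b := b) (u := w)) //.
by rewrite (eval_avoid E (x := w) (a := a) (b := b) (u := u)).
Qed.

Lemma eval_wheel s : has_matrix s -> has_table 3 (reach e) s ->
  eval n (arr s) [::] f_wheel = wheel_test e.
Proof.
move=> E T; rewrite -[LHS]/(has _ _) has_iota_ord; apply: eq_existsb => v.
rewrite -[LHS]/(has _ _) has_iota_ord; apply: eq_existsb => w.
rewrite -[LHS]/(has _ _) has_iota_ord; apply: eq_existsb => x.
rewrite -[LHS]/(has _ _) has_iota_ord; apply: eq_existsb => z.
set env := rcons _ _.
have jumpE i j (p q : 'I_n) : nth 0 env i = p -> nth 0 env j = q -> i < 4 -> j < 4 ->
    eval n (arr s) env (f_jump i j) = jump e v p q.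
  move=> Ei Ej i4 j4; rewrite -[LHS]/(has _ _) has_iota_ord; apply: eq_existsb => y.
  rewrite -[LHS]/(eval n (arr s) (rcons env y) (f_arc 4 j) &&
    (eval n (arr s) (rcons env y) (f_reach 3 0 0 0 4) &&
     ~~ eval n (arr s) (rcons env y) (f_reach 3 0 i i 4))).
  have old l : l < 4 -> nth 0 (rcons env y) l = nth 0 env l.
    by move=> l4; rewrite nth_rcons /= l4.
  rewrite (eval_arc E (u := y) (v := q)) ?(old j) //.
  rewrite (eval_reach T (x := v) (a := v) (b := v) (u := y)) //.
  by rewrite (eval_reach T (x := v) (a := p) (b := p) (u := y)) ?(old i).
have linkedE : eval n (arr s) env f_linked = linked e v w x z.
  rewrite -[LHS]/(~~ has _ _) has_iota_ord negb_exists; apply: eq_forallb => a.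
  rewrite -[LHS]/(~~ has _ _) has_iota_ord negb_exists; apply: eq_forallb => b.
  set env2 := rcons _ _.
  rewrite -[LHS]/(~~ ~~ ~~ (~~ eval n (arr s) env2 (f_reach 3 0 4 5 1) &&
    ~~ ~~ (~~ eval n (arr s) env2 (f_reach 3 0 4 5 2) &&
           ~~ eval n (arr s) env2 (f_reach 3 0 4 5 3)))).
  rewrite (eval_reach T (x := v) (a := a) (b := b) (u := w)) //.
  rewrite (eval_reach T (x := v) (a := a) (b := b) (u := x)) //.
  rewrite (eval_reach T (x := v) (a := a) (b := b) (u := z)) //.
  by do 3 case: (reach _ _ _ _ _).
rewrite -[LHS]/[&& eval n (arr s) env (f_jump 1 2), eval n (arr s) env (f_jump 2 3),
  eval n (arr s) env (f_reach 3 3 0 2 1), val z != val v & eval n (arr s) env f_linked].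
rewrite (jumpE _ _ w x) // (jumpE _ _ x z) // linkedE.
by rewrite (eval_reach T (x := z) (a := v) (b := x) (u := w)).
Qed.

End Correct.

(** * Running time *)

Fixpoint cost_coef f :=
  match f with
  | FEq _ _ => 2
  | FTab _ xs => 2 * size xs + 2
  | FNot f => cost_coef f + 1
  | FAnd f g => cost_coef f + (cost_coef g + 2)
  | FEx f => cost_coef f + 7
  end.

Fixpoint qdepth f :=
  match f with
  | FEq _ _ | FTab _ _ => 0
  | FNot f => qdepth f
  | FAnd f g => maxn (qdepth f) (qdepth g)
  | FEx f => (qdepth f).+1
  end.

Section Cost.

Variable n : nat.
Hypothesis n_gt0 : 0 < n.

Let pow_gt0 d : 0 < n ^ d. Proof. by rewrite expn_gt0 n_gt0. Qed.

(** As [n] is positive, lower-order terms are absorbed into the highest power. *)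
Lemma loop_bound A K d c0 c1 : A <= K * n ^ d ->
  n * (A + c0) + c1 <= (K + c0 + c1) * n ^ d.+1.
Proof.
move: (pow_gt0 d); rewrite expnS; move: (n ^ d) => N N0 le.
rewrite mulnDr !mulnDl !leq_add //.
- by rewrite mulnCA leq_mul2l le orbT.
- by rewrite mulnC leq_mul2l leq_pmulr ?orbT.
- by rewrite leq_pmulr // muln_gt0 n_gt0.
Qed.

Lemma cost_bound f : cost n f <= cost_coef f * n ^ qdepth f.
Proof.
elim: f => [i j|a xs|f IH|f IHf g IHg|f IH] /=; rewrite ?muln1 //.
- by move: (pow_gt0 (qdepth f)) IH; move: (n ^ _) => N; nia.
- rewrite !mulnDl; apply: leq_add.
    by apply: leq_trans IHf _; rewrite leq_mul2l leq_pexp2l ?leq_maxl ?orbT.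
  apply: leq_add; last by rewrite leq_pmulr.
  by apply: leq_trans IHg _; rewrite leq_mul2l leq_pexp2l ?leq_maxr ?orbT.
- by have := loop_bound 4 3 IH; rewrite -addnA.
Qed.

Lemma fill_cost_bound k lvl f :
  fill_cost n k lvl f <= (cost_coef f + 2 * (lvl + k) + 2 + 4 * k) * n ^ (qdepth f + k).
Proof.
elim: k lvl => [|k IH] lvl /=.
  rewrite !addn0.
  by move: (pow_gt0 (qdepth f)) (cost_bound f); move: (n ^ _) => N; nia.
have := loop_bound 2 2 (IH lvl.+1); rewrite -[(qdepth f + k).+1]addnS => le.
by apply: leq_trans le _; rewrite leq_mul2r; apply/orP; right; lia.
Qed.

End Cost.

(** * Correctness of the program *)

Section ProgramCorrect.

Variables (W n : nat) (e : rel 'I_n) (adj : 'I_n -> seq 'I_n).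
Hypotheses (nW : n ^ 4 + n + 2 <= W) (adjP : adjacency_lists e adj).

Let fill4_correct t f (R : 'I_n -> 'I_n -> 'I_n -> 'I_n -> bool) s :
  wf 4 f -> 2 < t -> t \notin tables f -> reg s 0 = n -> bool_tables s ->
  has_matrix e s ->
  (forall x a b u : 'I_n,
     eval n (arr s) [:: val x; val a; val b; val u] f = R x a b u) ->
  runs W (fill 4 0 t f) s (fill_cost n 4 0 f) (fun s' =>
    [/\ reg s' 0 = n, reg s' 3 = reg s 3, bool_tables s' &
        has_matrix e s' /\ has_table t R s']).
Proof.
move=> wff t2 tf r0 bt mat ev.
have t1 : 1 < t by lia.
have henv : holds_env n s [::] by [].
apply: (runs_weaken (fill_correct nW (k := 4) (lvl := 0) (env := [::]) wff t1 tf isT erefl henv bt)) => //.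
move=> s' [ag bt' off ent]; split=> //; [by rewrite ag|by rewrite ag|].
split; first by move=> x y; rewrite off //; lia.
by move=> x b c u; rewrite ent //= ?ltn_ord // ev.
Qed.

Definition total_cost : nat :=
  (n * (n * 6 + 3 + 2) + 2) + (fill_cost n 4 0 f_init +
  ((n * ((fill_cost n 4 0 (f_step 3) + fill_cost n 4 0 (f_step 4)) + 2) + 2) +
   (cost n f_wheel + 1))).

Lemma W3_program_correct :
  runs W W3_program (input_state adj) total_cost (fun s => reg s 0 = wheel_test e).
Proof.
apply: runs_seq; apply: (runs_weaken (load_correct adjP nW)) => // s1 [r0 [_ _ bt mat]].
apply: runs_seq.
apply: (runs_weaken (fill4_correct (R := reach_le e 0) (f := f_init) _ _ _ r0 bt mat _)) => //.
  by move=> x a b u; apply: eval_avoid mat _ _ _ _.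
move=> s2 [r20 _ bt2 [mat2 tab2]]; apply: runs_seq.
pose Inv k s := [/\ bool_tables s, has_matrix e s & has_table 3 (reach_le e (2 * k)) s].
apply: (runs_weaken (@runs_for _ 3 _ n
  (fill_cost n 4 0 (f_step 3) + fill_cost n 4 0 (f_step 4)) Inv s2 _ _ _ _ _)) => //.
- by lia.
- move=> k s kn r3 rs0 [bts mats tabs]; apply: runs_seq.
  apply: (runs_weaken (fill4_correct (R := reach_le e (2 * k).+1) (f := f_step 3)
    _ _ _ rs0 bts mats _)) => //; first by move=> *; apply: eval_step.
  move=> s' [r0' r3' bt' [mat' tab']].
  apply: (runs_weaken (fill4_correct (R := reach_le e (2 * k).+2) (f := f_step 4)
    _ _ _ r0' bt' mat' _)) => //; first by move=> *; apply: eval_step.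
  move=> s'' [r0'' r3'' bt'' [mat'' tab'']]; split; rewrite ?r3'' ?r3' //.
  by split=> //; rewrite mulnS add2n.
move=> s3 [r30 [bt3 mat3 tab3]]; apply: runs_seq.
have henv : holds_env n s3 [::] by [].
apply: (runs_weaken (compile_correct nW (lvl := 0) (f := f_wheel) _ _ henv bt3)) => //.
move=> s4 [_ r1 _]; apply: runs_assign; rewrite /= r1 addn0.
  by case: eval; lia.
(* [reach_leE] applies because [2 * n] is at least the number of vertices. *)
rewrite (eval_wheel (e := e)) // => x a b u; rewrite tab3 reach_leE // card_ord; lia.
Qed.

End ProgramCorrect.

(** The exponent leaves slack: [n] rounds of order [n ^ 5] and a formula of quantifier depth 6 are
    both of order [n ^ 6], while the theorem allows [n ^ 7]. *)
Lemma total_cost_bound : exists C, forall n, 0 < n -> total_cost n <= C * n ^ 7.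
Proof.
have pow n d K : 0 < n -> d <= 7 -> K * n ^ d <= K * n ^ 7.
  by move=> n0 d7; rewrite leq_mul2l leq_pexp2l ?orbT.
have fillB f k : exists K, forall n, 0 < n -> qdepth f + 4 <= k ->
    fill_cost n 4 0 f <= K * n ^ k.
  exists (cost_coef f + 2 * (0 + 4) + 2 + 4 * 4) => n n0 fk.
  apply: leq_trans (fill_cost_bound n0 4 0 f) _.
  by rewrite leq_mul2l leq_pexp2l ?orbT.
have [K1 H1] := fillB f_init 7; have [K2 H2] := fillB (f_step 3) 6.
have [K3 H3] := fillB (f_step 4) 6.
(* The constant 13 is [6 + 5 + 2], from the cost of loading. *)
exists (13 + (K1 + ((K2 + K3 + 2 + 2) + (cost_coef f_wheel + 1)))) => n n0.
rewrite /total_cost mulnDl; apply: leq_add.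
  by apply: leq_trans (pow n 2 13 n0 isT); rewrite expnS expn1; nia.
rewrite mulnDl; apply: leq_add; first exact: H1.
rewrite mulnDl; apply: leq_add.
  apply: loop_bound => //; rewrite mulnDl; apply: leq_add; [exact: H2|exact: H3].
rewrite mulnDl; apply: leq_add; last by rewrite mul1n expn_gt0 n0.
by apply: leq_trans (cost_bound n0 f_wheel) _; apply: pow.
Qed.

Theorem theorem21 :
  solvable_in_time_O (contains_subdivision W3)
    (fun n m : nat => n ^ 6 * (n + m)).
Proof.
have [C HC] := total_cost_bound.
exists W3_program, 5, C => n e e_irr adj adjP D m.
(* The fifth factor is at least 2: one copy of [(n + 2) ^ 4] pays for [n ^ 4], another for
   [n + 2]. *)
have nW : n ^ 4 + n + 2 <= (n + m + 2) ^ 5.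
  have l1 : (n + 2) ^ 5 <= (n + m + 2) ^ 5 by rewrite leq_exp2r //; lia.
  apply: leq_trans l1; rewrite expnSr.
  have l2 : n ^ 4 <= (n + 2) ^ 4 by rewrite leq_exp2r //; lia.
  have l3 : n + 2 <= (n + 2) ^ 4 by apply: (@leq_pexp2l (n + 2) 1 4); lia.
  nia.
have [t [s [E le r0]]] := W3_program_correct nW adjP.
exists t, s; split=> //.
  have WP := contains_W3P D; rewrite r0.
  by case: (boolP (wheel_test e)) => wt; [left | right]; split=> //; [apply/WP | move/WP; apply/negP].
(* [n ^ 7] is [n ^ 6 * n], which is at most [n ^ 6 * (n + m)]. *)
move=> n0; apply: leq_trans le (leq_trans (HC _ n0) _).
by rewrite leq_mul2l expnSr leq_mul2l leq_addr !orbT.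
Qed.
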